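(* There is an algorithm that, given the adjacency list representation of a unit disk graph $G$ with $n$ vertices and $m$ edges, outputs in $O(n^2 m)$ time a dominating set $D$ of $G$ with $|D| \le \frac{43}{9}\,|D^*|$, where $D^*$ is a minimum dominating set of $G$.
   Context: A unit disk graph is a graph whose vertices can be mapped to points in the Euclidean plane so that two vertices are adjacent if and only if the corresponding points are at Euclidean distance at most $1$. A dominating set of a graph $G=(V,E)$ is a set $D\subseteq V$ such that every vertex not in $D$ is adjacent to some vertex of $D$; a minimum dominating set is one of smallest cardinality.
   Formalization: The O(n^2 m) time bound is claimed only for graphs with at least one edge, since for m = 0 it would be zero and no algorithm meets it; for edgeless graphs the algorithm still halts and outputs a dominating set within the ratio 43/9. *)

(* Defs.v *)
From mathcomp Require Import all_boot all_order all_algebra.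
From mathcomp Require Import reals.

Set Implicit Arguments.
Unset Strict Implicit.
Unset Printing Implicit Defensive.

Import Order.TTheory GRing.Theory Num.Theory.

Section Graphs.
Variables (T : finType) (e : rel T).

Definition simple_graph : Prop := symmetric e /\ irreflexive e.

Definition edges : {set {set T}} :=
  [set [set p.1; p.2] | p : T * T & e p.1 p.2].

Definition dominating (D : {set T}) : Prop :=
  forall v, v \notin D -> exists2 u, u \in D & e v u.

Definition minimum_dominating (D : {set T}) : Prop :=
  dominating D /\ forall D', dominating D' -> #|D| <= #|D'|.

End Graphs.

(* The library norm on R * R is the sup norm, hence this explicit distance. *)
Definition euclidean_dist (R : realType) (p q : R * R) : R :=
  Num.sqrt ((p.1 - q.1) ^+ 2 + (p.2 - q.2) ^+ 2)%R.

(* Distinct vertices may be mapped to the same point. *)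
Definition unit_disk_graph (R : realType) (T : finType) (e : rel T) : Prop :=
  simple_graph e /\
  exists p : T -> R * R,
    forall u v, u != v -> e u v = (euclidean_dist (p u) (p v) <= 1)%R.

(* Machine model: a word RAM with w-bit words, programmed in a structured     *)
(* language.  A program uses finitely many word variables and finitely many   *)
(* random-access arrays; variables and arrays are named by numerals occurring *)
(* in the program text, so that only array indices are computed at run time.  *)
(* Every operation on words, every array access and every test costs one      *)
(* unit.  Reducing results modulo 2 ^ w keeps all computed values, hence all  *)
(* addresses, within one word.                                                *)

Inductive binop := Add | Sub | Mul | Div | Mod | Lt | Eq.

Inductive expr :=
  | Const of nat
  | Var of nat
  | Get of nat & expr
  | Bin of binop & expr & expr.

Inductive cmd :=
  | Skip
  | Assign of nat & expr
  | Put of nat & expr & expr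
  | Seq of cmd & cmd
  | If of expr & cmd & cmd
  | While of expr & cmd.

Record state := State { var : nat -> nat; arr : nat -> nat -> nat }.

Definition upd (A : Type) (f : nat -> A) (x : nat) (v : A) : nat -> A :=
  fun y => if y == x then v else f y.

Definition set_var (s : state) (x v : nat) : state :=
  State (upd (var s) x v) (arr s).

Definition set_arr (s : state) (a i v : nat) : state :=
  State (var s) (upd (arr s) a (upd (arr s a) i v)).

(* Subtraction is truncated at 0; a %/ 0 = 0 and a %% 0 = a. *)
Definition binop_eval (w : nat) (o : binop) (a b : nat) : nat :=
  match o with
  | Add => (a + b) %% 2 ^ w
  | Sub => a - b
  | Mul => (a * b) %% 2 ^ w
  | Div => a %/ b
  | Mod => a %% b
  | Lt => nat_of_bool (a < b)
  | Eq => nat_of_bool (a == b)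
  end.

Fixpoint eval (w : nat) (s : state) (x : expr) : nat :=
  match x with
  | Const c => c %% 2 ^ w
  | Var i => var s i
  | Get a x1 => arr s a (eval w s x1)
  | Bin o x1 x2 => binop_eval w o (eval w s x1) (eval w s x2)
  end.

Fixpoint expr_cost (x : expr) : nat :=
  match x with
  | Const _ | Var _ => 1
  | Get _ x1 => (expr_cost x1).+1
  | Bin _ x1 x2 => (expr_cost x1 + expr_cost x2).+1
  end.

(* [exec w c s s' t]: started in [s], the program [c] halts in [s'] after     *)
(* exactly [t] time units.                                                    *)
Inductive exec (w : nat) : cmd -> state -> state -> nat -> Prop :=
  | exec_skip s : exec w Skip s s 1
  | exec_assign x b s :
      exec w (Assign x b) s (set_var s x (eval w s b)) (expr_cost b).+1
  | exec_put a i b s :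
      exec w (Put a i b) s (set_arr s a (eval w s i) (eval w s b))
        (expr_cost i + expr_cost b).+1
  | exec_seq c1 c2 s1 s2 s3 t1 t2 :
      exec w c1 s1 s2 t1 -> exec w c2 s2 s3 t2 ->
      exec w (Seq c1 c2) s1 s3 (t1 + t2)
  | exec_if b c1 c2 s s' t :
      exec w (if eval w s b != 0 then c1 else c2) s s' t ->
      exec w (If b c1 c2) s s' (expr_cost b + t).+1
  | exec_while_stop b c s :
      eval w s b = 0 -> exec w (While b c) s s (expr_cost b).+1
  | exec_while_step b c s1 s2 s3 t1 t2 :
      eval w s1 b <> 0 -> exec w c s1 s2 t1 -> exec w (While b c) s2 s3 t2 ->
      exec w (While b c) s1 s3 (expr_cost b + t1 + t2).+1.

Lemma exec_det w c s s1 s2 t1 t2 :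
  exec w c s s1 t1 -> exec w c s s2 t2 -> s1 = s2 /\ t1 = t2.
Proof.
move=> H; elim: H s2 t2 => {c s s1 t1};
  intros; match goal with H : exec _ _ _ _ _ |- _ => inversion H; subst end;
  try done;
  repeat match goal with
    IH : (forall s t, exec ?w ?c ?s0 s t -> _), H : exec ?w ?c ?s0 _ _ |- _ =>
      case: (IH _ _ H) => ? ?; subst; clear IH H end; done.
Qed.

(* The neighbours of each vertex are listed once each, in arbitrary order. *)
Definition adjacency_lists (n : nat) (e : rel 'I_n) (L : 'I_n -> seq 'I_n) :
    Prop :=
  forall v, uniq (L v) /\ L v =i e v.

(* Variable 0 holds n.  Array 1 is the concatenation of the lists, and the    *)
(* list of vertex v occupies its cells of index i such that array 0 at v is   *)
(* at most i and array 0 at v + 1 exceeds i.  Everything else is zero.        *)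
Definition adj_offset (n : nat) (L : 'I_n -> seq 'I_n) (v : nat) : nat :=
  \sum_(u < n | u < v) size (L u).

Definition adj_concat (n : nat) (L : 'I_n -> seq 'I_n) : seq nat :=
  flatten [seq [seq val u | u <- L v] | v <- enum 'I_n].

Definition input_state (n : nat) (L : 'I_n -> seq 'I_n) : state :=
  State
    (fun x => if x == 0 then n else 0)
    (fun a i => match a with
                | 0 => if i <= n then adj_offset L i else 0
                | 1 => nth 0 (adj_concat L) i
                | _ => 0
                end).

(* Variable 0 holds the cardinality of the output set, whose elements are     *)
(* listed in the first cells of array 0.                                      *)
Definition outputs (n : nat) (s : state) (D : {set 'I_n}) : Prop :=
  perm_eq [seq arr s 0 i | i <- iota 0 (var s 0)] [seq val v | v <- enum D].

(* Main.v *)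
Require Import Defs.
From mathcomp Require Import all_boot all_order all_algebra.
From mathcomp Require Import reals.
From mathcomp Require Import ring lra zify.

(** Local search on maximal independent sets: as long as some vertex c allows it,
    replace the current set D by a smaller maximal independent set containing c
    and the members of D that are not adjacent to c.

    At a local optimum D, charge every member of D to a dominator in a
    dominating set B.  As six points of a unit disk cannot be pairwise at
    distance more than 1, every d in B receives at most 5 charges; call the
    difference its deficit.  If c receives 5 charges, the failure of the exchange
    at c yields four independent vertices, outside the closed neighbourhood of
    c, whose neighbours in D are all charged to c.  Those of them that a given
    d in B dominates are independent of the vertices charged to d, so they
    are at most as many as the deficit of d.

    A vertex d sees in this way at most 14 such c: for each of them there are a
    neighbour v of d and a neighbour x of v in D, with v and x at distance more
    than 1 from the x of every other such c, and two such x are seen from d at an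
    angle exceeding the opening of the sectors of a partition of the plane into
    14 sectors.  Hence four times the number of fully charged vertices is at most
    14 times the total deficit, and the total deficit is at least 2/9 of |B|. *)

Set Implicit Arguments.
Unset Strict Implicit.
Unset Printing Implicit Defensive.

Import Order.TTheory GRing.Theory Num.Theory.

(** * Unit disks in the plane *)

Section Plane.
Variable R : realType.
Local Open Scope ring_scope.
Implicit Types p q x v : R * R.

Definition dot p q : R := p.1 * q.1 + p.2 * q.2.
Definition cross p q : R := p.1 * q.2 - p.2 * q.1.
Definition sqdist p q : R := (p.1 - q.1) ^+ 2 + (p.2 - q.2) ^+ 2.

Lemma euclidean_dist_le1 p q : (euclidean_dist p q <= 1) = (sqdist p q <= 1).
Proof. by rewrite /euclidean_dist -/(sqdist p q) -{1}(sqrtr1 R) ler_sqrt. Qed.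

Lemma sqdist_subr p q x : sqdist (p - x) (q - x) = sqdist p q.
Proof. by rewrite /sqdist /=; ring. Qed.

Lemma sum_squares_le0 (x y : R) : x * x + y * y <= 0 -> x = 0 /\ y = 0.
Proof.
move=> h; have x0 := sqr_ge0 x; have y0 := sqr_ge0 y.
by split; apply/eqP; rewrite -sqrf_eq0; apply/eqP; lra.
Qed.

(** * Sixty-degree sectors and independent points of a unit disk *)

(** The squared norm of a vector with coordinates [i] and [j] in a basis of two unit vectors at 60
    degrees. *)
Definition hex (i j : R) : R := i ^+ 2 + i * j + j ^+ 2.

(** In a triangle whose angle at the origin is at most 60 degrees, the opposite side is at most the
    longer of the other two. *)
Lemma hex_sub_le (M i j i' j' : R) :
  0 <= i -> 0 <= j -> 0 <= i' -> 0 <= j' ->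
  hex i j <= M -> hex i' j' <= M -> hex (i - i') (j - j') <= M.
Proof.
rewrite /hex => i0 j0 i0' j0'.
have ij := mulr_ge0 i0 j0; have ij' := mulr_ge0 i0' j0'.
have := mulr_ge0 i0 i0'; have := mulr_ge0 j0 j0'.
have := mulr_ge0 i0 j0'; have := mulr_ge0 i0' j0 => h1 h2 h3 h4 hM hM'.
case: (leP i' i) => hi; case: (leP j' j) => hj; nra.
Qed.

(** This and the next four identities are isometries, each carrying one of the other five sectors to
    the sector of nonnegative coordinates. *)
Lemma hexN (i j : R) : hex (- i) (- j) = hex i j.
Proof. by rewrite /hex; ring. Qed.

Lemma hex_rot (i j : R) : hex (- i) (i + j) = hex i j.
Proof. by rewrite /hex; ring. Qed.

Lemma hex_rot2 (i j : R) : hex j (- i - j) = hex i j.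
Proof. by rewrite /hex; ring. Qed.

Lemma hex_rot4 (i j : R) : hex i (- i - j) = hex i j.
Proof. by rewrite /hex; ring. Qed.

Lemma hex_rot5 (i j : R) : hex (i + j) (- j) = hex i j.
Proof. by rewrite /hex; ring. Qed.

(** Two bits suffice to tell apart the four sectors that do not border the ray [i >= 0], [j = 0]. *)
Definition hex_sector (i j : R) : bool * bool :=
  (0 <= j, if 0 <= j then 0 <= i + j else i <= 0).

Lemma hex_sector_close (M i j i' j' : R) :
  ~~ ((0 <= i) && (0 <= j)) -> ~~ ((j <= 0) && (0 <= i + j)) ->
  ~~ ((0 <= i') && (0 <= j')) -> ~~ ((j' <= 0) && (0 <= i' + j')) ->
  hex_sector i j = hex_sector i' j' ->
  hex i j <= M -> hex i' j' <= M -> hex (i - i') (j - j') <= M.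
Proof.
have rot1 : 0 <= - i -> 0 <= i + j -> 0 <= - i' -> 0 <= i' + j' ->
    hex i j <= M -> hex i' j' <= M -> hex (i - i') (j - j') <= M.
  move=> *; rewrite -hex_rot (_ : - (i - i') = - i - - i'); last by ring.
  rewrite (_ : i - i' + (j - j') = i + j - (i' + j')); last by ring.
  by apply: hex_sub_le; rewrite ?hex_rot.
have rot2 : 0 <= j -> 0 <= - i - j -> 0 <= j' -> 0 <= - i' - j' ->
    hex i j <= M -> hex i' j' <= M -> hex (i - i') (j - j') <= M.
  move=> *; rewrite -hex_rot2.
  rewrite (_ : - (i - i') - (j - j') = - i - j - (- i' - j')); last by ring.
  by apply: hex_sub_le; rewrite ?hex_rot2.
have rot3 : 0 <= - i -> 0 <= - j -> 0 <= - i' -> 0 <= - j' ->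
    hex i j <= M -> hex i' j' <= M -> hex (i - i') (j - j') <= M.
  move=> *; rewrite -hexN (_ : - (i - i') = - i - - i'); last by ring.
  rewrite (_ : - (j - j') = - j - - j'); last by ring.
  by apply: hex_sub_le; rewrite ?hexN.
have rot4 : 0 <= i -> 0 <= - i - j -> 0 <= i' -> 0 <= - i' - j' ->
    hex i j <= M -> hex i' j' <= M -> hex (i - i') (j - j') <= M.
  move=> *; rewrite -hex_rot4.
  rewrite (_ : - (i - i') - (j - j') = - i - j - (- i' - j')); last by ring.
  by apply: hex_sub_le; rewrite ?hex_rot4.
rewrite /hex_sector => a b a' b'.
have {}a : 0 <= j -> i < 0 by move=> h; move: a; rewrite h andbT -ltNge.
have {}a' : 0 <= j' -> i' < 0 by move=> h; move: a'; rewrite h andbT -ltNge.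
have {}b : j < 0 -> i + j < 0 by move=> h; move: b; rewrite ltW //= -ltNge.
have {}b' : j' < 0 -> i' + j' < 0 by move=> h; move: b'; rewrite ltW //= -ltNge.
case: (leP 0 j) a b => [hj /(_ isT) a _|hj _ /(_ isT) b];
case: (leP 0 j') a' b' => [hj' /(_ isT) a' _|hj' _ /(_ isT) b'] [] //.
  case: (leP 0 (i + j)) => ?; case: (leP 0 (i' + j')) => // ? _.
    by apply: rot1 => //; lra.
  by apply: rot2 => //; lra.
case: (leP i 0) => ?; case: (leP i' 0) => // ? _.
  by apply: rot3 => //; lra.
by apply: rot4 => //; lra.
Qed.

(* Coordinates of [q] in the basis formed by [p] and its rotation by 60 degrees,
   up to the common factor [cross p (rot60 p)]; [hex] is then a multiple of the
   squared norm. *)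
Definition hex_fst p q : R :=
  cross q (p.1 / 2 - Num.sqrt 3 / 2 * p.2, Num.sqrt 3 / 2 * p.1 + p.2 / 2).

Lemma hexE p q :
  hex (hex_fst p q) (cross p q) = 3 / 4 * dot p p * dot q q.
Proof.
have s3 : Num.sqrt 3 ^+ 2 = 3 :> R by rewrite sqr_sqrtr.
rewrite /hex /hex_fst /cross /dot /=.
set t := Num.sqrt 3 in s3 *.
apply/eqP; rewrite -subr_eq0; apply/eqP.
transitivity ((t ^+ 2 - 3) * (p.1 * q.1 + p.2 * q.2) ^+ 2 / 4); first by field.
by rewrite s3 subrr !mul0r.
Qed.

Lemma hex_fstB p q q' : hex_fst p (q - q') = hex_fst p q - hex_fst p q'.
Proof. by rewrite /hex_fst /cross /=; ring. Qed.

Lemma crossB p q q' : cross p (q - q') = cross p q - cross p q'.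
Proof. by rewrite /cross /=; ring. Qed.

(** Measure angles at [o] from the direction of some [u0] in [S]. Another member in one of the two
    60-degree sectors bordering that direction would be close to [u0], and each of the four
    remaining sectors holds at most one member. *)
Lemma independent_in_disk (T : finType) (S : {set T}) (f : T -> R * R)
    (o : R * R) :
  {in S, forall u, sqdist o (f u) <= 1} ->
  {in S &, forall u v : T, u != v -> 1 < sqdist (f u) (f v)} ->
  (#|S| <= 5)%N.
Proof.
move=> inD far; have [->|[u0 u0S]] := set_0Vmem S; first by rewrite cards0.
have sqE (u v : T) : sqdist (f u) (f v) = dot (f u - o - (f v - o)) (f u - o - (f v - o)).
  by rewrite /sqdist /dot /=; ring.
have inD' u : u \in S -> dot (f u - o) (f u - o) <= 1.
  by move/inD; rewrite /sqdist /dot /=; lra.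
set p := f u0 - o.
(* If [p] vanished, [u0] would sit at [o], within distance 1 of every other member. *)
have p_gt0 u : u \in S -> u != u0 -> 0 < dot p p.
  move=> uS nu; have := far _ _ uS u0S nu; have := inD' _ uS.
  rewrite sqE -/p; case: (f u - o) p => [x y] [X Y]; rewrite /dot /= => h1 h2.
  by rewrite ltNge; apply/negP => /sum_squares_le0[Xe Ye]; subst; lra.
pose I u := hex_fst p (f u - o); pose J u := cross p (f u - o).
(* By [hexE], [3 / 4 * dot p p] is the value of [hex] on unit vectors. *)
have hexle u : u \in S -> hex (I u) (J u) <= 3 / 4 * dot p p.
  move=> uS; rewrite hexE; have := inD' _ uS.
  rewrite -{2}[3 / 4 * dot p p]mulr1; apply: ler_wpM2l.
  by have := sqr_ge0 p.1; have := sqr_ge0 p.2; rewrite /dot; lra.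
have near (u v : T) : u \in S -> u != u0 ->
    hex (I u - I v) (J u - J v) <= 3 / 4 * dot p p -> sqdist (f u) (f v) <= 1.
  move=> uS nu; rewrite /I /J -hex_fstB -crossB hexE sqE.
  rewrite -[X in _ <= X]mulr1 ler_pM2l //.
  by have := p_gt0 _ uS nu; lra.
have I0 : 0 <= I u0.
  rewrite /I -/p (_ : hex_fst p p = Num.sqrt 3 / 2 * dot p p); last first.
    by rewrite /hex_fst /cross /dot /=; field.
  rewrite mulr_ge0 ?divr_ge0 ?sqrtr_ge0 //.
  by have := sqr_ge0 p.1; have := sqr_ge0 p.2; rewrite /dot; lra.
have J0 : J u0 = 0 by rewrite /J -/p /cross; ring.
have far0 u : u \in S -> u != u0 ->
   ~~ ((0 <= I u) && (0 <= J u)) /\ ~~ ((J u <= 0) && (0 <= I u + J u)).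
  move=> uS nu; have fu := far _ _ uS u0S nu.
  split; apply/negP => /andP[h1 h2]; move: fu; rewrite ltNge => /negP; apply;
    apply: near => //.
    by apply: hex_sub_le => //; rewrite ?J0 //; [apply: hexle |
      rewrite -J0; apply: hexle].
  rewrite -hex_rot5 (_ : - (J u - J u0) = - J u - - J u0); last by ring.
  rewrite (_ : I u - I u0 + (J u - J u0) = I u + J u - (I u0 + J u0));
    last by ring.
  by apply: hex_sub_le; rewrite ?hex_rot5; first [lra | exact: hexle].
rewrite (cardsD1 u0) u0S add1n ltnS (_ : 4 = #|{: bool * bool}|)%N;
  last by rewrite card_prod card_bool.
apply: (@leq_card_in _ _ (fun u => hex_sector (I u) (J u))) => u v.
rewrite !inE => /andP[nu uS] /andP[nv vS] eqs; apply: contraTeq isT => nuv.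
have [a b] := far0 _ uS nu; have [a' b'] := far0 _ vS nv.
have := far _ _ uS vS nuv; rewrite ltNge => /negP[]; apply: near => //.
by apply: (hex_sector_close a b a' b' eqs); apply: hexle.
Qed.

(* In coordinates with the longer of the two vectors on the first axis: the
   vector [(a, b)] is either in the intersection of all unit disks containing
   both [0] and [(s, 0)], or at distance at most 1 from [(s, 0)]. *)
Lemma witness_axis (s a b p q : R) :
  0 <= s -> p ^+ 2 + q ^+ 2 <= 1 -> (p - s) ^+ 2 + q ^+ 2 <= 1 ->
  1 < (a - p) ^+ 2 + (b - q) ^+ 2 -> 1 < (a - s) ^+ 2 + b ^+ 2 ->
  a ^+ 2 + b ^+ 2 <= s ^+ 2 -> 0 <= b -> 29 * b <= 15 * a -> False.
Proof.
move=> s0 v0 vs va1 as1 aLs b0 ba.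
have a0 : 0 <= a by lra.
have sgt : 0 < s.
  by rewrite lt_neqAle s0 andbT; apply/negP => /eqP se; subst s; nra.
have aleqs : a <= s by rewrite -(ler_pXn2r (n := 2)) ?nnegrE //; nra.
set t := s - a; have t0 : 0 <= t by rewrite subr_ge0.
(* Stewart's theorem for the foot [(a, 0)], which cuts the segment from the origin to [(s, 0)] into
   lengths [a] and [t]. *)
have key : a * t < b * (b - 2 * q).
  have : s * ((a - p) ^+ 2 + (b - q) ^+ 2 - 1) =
     t * (p ^+ 2 + q ^+ 2 - 1) + a * ((p - s) ^+ 2 + q ^+ 2 - 1)
     + s * (b * (b - 2 * q) - a * t) by rewrite /t; ring.
  have : 0 < s * ((a - p) ^+ 2 + (b - q) ^+ 2 - 1) by apply: mulr_gt0; lra.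
  have : t * (p ^+ 2 + q ^+ 2 - 1) <= 0 by apply: mulr_ge0_le0; lra.
  have : a * ((p - s) ^+ 2 + q ^+ 2 - 1) <= 0 by apply: mulr_ge0_le0; lra.
  move=> h1 h2 h3 h4; have : 0 < s * (b * (b - 2 * q) - a * t) by lra.
  by rewrite pmulr_rgt0 // subr_gt0.
have at0 : 0 <= a * t by apply: mulr_ge0.
have bgt : 0 < b.
  by rewrite lt_neqAle b0 andbT; apply/negP => /eqP be; rewrite -be in key; lra.
(* The point [(p, q)] lies in the lens of two unit disks with centres at distance [s], whose
   half-height squared is [1 - s ^+ 2 / 4]. *)
have q2 : 4 * q ^+ 2 <= 4 - (a + t) ^+ 2.
  have -> : a + t = s by rewrite /t; ring.
  have : 0 <= (2 * p - s) ^+ 2 by apply: sqr_ge0.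
  by lra.
have tb1 : 1 < t ^+ 2 + b ^+ 2.
  by move: as1; rewrite (_ : (a - s) ^+ 2 = t ^+ 2) //; rewrite /t; ring.
have b2 : 841 * b ^+ 2 <= 225 * a ^+ 2.
  have := mulr_ge0 (_ : 0 <= 15 * a - 29 * b) (_ : 0 <= 15 * a + 29 * b).
  move=> /(_ ltac:(lra) ltac:(lra)); lra.
(* The sum of [(a * t - b ^+ 2) ^+ 2] and [(a + t) ^+ 2 * b ^+ 2] factors as
   [(a ^+ 2 + b ^+ 2) * (t ^+ 2 + b ^+ 2)]. So [key] and [q2] force [a ^+ 2 < 3 * b ^+ 2], against
   [b2]. *)
case: (leP (b ^+ 2) (a * t)) => [large|small].
  have : (a * t - b ^+ 2) ^+ 2 < (2 * q) ^+ 2 * b ^+ 2.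
    rewrite -exprMn -[X in _ < X]sqrrN ltr_pXn2r ?nnegrE //; lra.
  have : (2 * q) ^+ 2 * b ^+ 2 <= (4 - (a + t) ^+ 2) * b ^+ 2.
    by apply: ler_wpM2r; [exact: sqr_ge0 | rewrite exprMn; lra].
  have : 0 < (a ^+ 2 + b ^+ 2) * (t ^+ 2 + b ^+ 2 - 1).
    by apply: mulr_gt0; [have := exprn_gt0 2 bgt; have := sqr_ge0 a; lra | lra].
  by have := exprn_gt0 2 bgt; lra.
have st : a + t <= 2.
  rewrite -(ler_pXn2r (n := 2)) ?nnegrE //; last lra.
  by have := sqr_ge0 q; lra.
have aLs' : b ^+ 2 <= 2 * (a * t) + t ^+ 2.
  by move: aLs; rewrite (_ : s = a + t); [lra | rewrite /t; ring].
(* For [t <= 1 / 4], [t ^+ 2 + b ^+ 2] is at most [2 * t * (a + t)], hence at most 1. *)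
case: (leP t (1 / 4)) => ht.
  have : t * (a + t) <= 1 / 4 * 2 by apply: ler_pM; lra.
  by lra.
(* Otherwise [t] lies between 1/4 and 0.43, where [b2] and [a <= 2 - t] keep [t ^+ 2 + b ^+ 2] below
   1. *)
have ta : 841 * t <= 225 * a.
  have agt : 0 < a by lra.
  by rewrite -(ler_pM2l agt); lra.
by nra.
Qed.

(** An isometry puts the longer vector [x2] on the first axis with [x1] on the nonnegative side of
    it, which is the situation of [witness_axis]. *)
Lemma witness_angle x1 x2 v :
  dot v v <= 1 -> sqdist v x2 <= 1 -> 1 < sqdist v x1 -> 1 < sqdist x1 x2 ->
  dot x1 x1 <= dot x2 x2 -> 29 * `|cross x1 x2| <= 15 * dot x1 x2 -> False.
Proof.
case: x1 x2 v => [a1 b1] [X Y] [p q]; rewrite /dot /cross /sqdist /=.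
move=> v0 vx2 vx1 x12 n12 ang.
have S0 : 0 <= X * X + Y * Y by have := sqr_ge0 X; have := sqr_ge0 Y; lra.
set s := Num.sqrt (X * X + Y * Y).
have s2 : s ^+ 2 = X * X + Y * Y by rewrite sqr_sqrtr.
have s0 : 0 <= s by exact: sqrtr_ge0.
case: (eqVneq s 0) => [se|sn].
  have [Xe Ye] : X = 0 /\ Y = 0 by apply: sum_squares_le0; rewrite -s2 se; lra.
  have [ae be] : a1 = 0 /\ b1 = 0 by apply: sum_squares_le0; rewrite Xe Ye in n12; lra.
  by subst; lra.
have sgt : 0 < s by rewrite lt_neqAle eq_sym sn.
have rotE (x y : R) : ((x * X + y * Y) / s) ^+ 2 + ((x * Y - y * X) / s) ^+ 2
    = x * x + y * y.
  transitivity ((x * x + y * y) * (X * X + Y * Y) / s ^+ 2); first by field.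
  by rewrite s2 mulfK // -s2 expf_neq0.
have Xs : (X * X + Y * Y) / s = s by rewrite -s2; field.
have vx2' : ((p * X + q * Y) / s - s) ^+ 2 + ((p * Y - q * X) / s) ^+ 2 <= 1.
  have := rotE (p - X) (q - Y).
  rewrite (_ : ((p - X) * X + (q - Y) * Y) / s = (p * X + q * Y) / s - s);
    last by rewrite -{3}Xs; field.
  rewrite (_ : ((p - X) * Y - (q - Y) * X) / s = (p * Y - q * X) / s);
    last by field.
  by move=> ->; lra.
have x12' : 1 < ((a1 * X + b1 * Y) / s - s) ^+ 2 + ((a1 * Y - b1 * X) / s) ^+ 2.
  have := rotE (a1 - X) (b1 - Y).
  rewrite (_ : ((a1 - X) * X + (b1 - Y) * Y) / s = (a1 * X + b1 * Y) / s - s);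
    last by rewrite -{3}Xs; field.
  rewrite (_ : ((a1 - X) * Y - (b1 - Y) * X) / s = (a1 * Y - b1 * X) / s);
    last by field.
  by move=> ->; lra.
have vx1' : 1 < ((a1 * X + b1 * Y) / s - (p * X + q * Y) / s) ^+ 2
    + ((a1 * Y - b1 * X) / s - (p * Y - q * X) / s) ^+ 2.
  have := rotE (a1 - p) (b1 - q).
  rewrite (_ : ((a1 - p) * X + (b1 - q) * Y) / s
    = (a1 * X + b1 * Y) / s - (p * X + q * Y) / s); last by field.
  rewrite (_ : ((a1 - p) * Y - (b1 - q) * X) / s
    = (a1 * Y - b1 * X) / s - (p * Y - q * X) / s); last by field.
  by move=> ->; lra.
have vv := rotE p q; have aa := rotE a1 b1.
have angp : 29 * ((a1 * Y - b1 * X) / s) <= 15 * ((a1 * X + b1 * Y) / s).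
  rewrite !mulrA ler_pM2r ?invr_gt0 //.
  by have := ler_norm (a1 * Y - b1 * X); lra.
have angm : 29 * - ((a1 * Y - b1 * X) / s) <= 15 * ((a1 * X + b1 * Y) / s).
  rewrite -mulNr !mulrA ler_pM2r ?invr_gt0 //.
  by have := ler_norm (- (a1 * Y - b1 * X)); rewrite normrN; lra.
move: angp angm vx2' x12' vx1' vv aa.
move: ((a1 * Y - b1 * X) / s) ((a1 * X + b1 * Y) / s) => b a.
move: ((p * Y - q * X) / s) ((p * X + q * Y) / s) => q' p'.
move=> angp angm vx2' x12' vx1' vv aa.
case: (leP 0 b) => hb.
  by apply: (@witness_axis s a b p' q') => //; rewrite ?s2; lra.
by apply: (@witness_axis s a (- b) p' (- q')) => //; rewrite ?s2; lra.
Qed.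

(** * Sectors narrower than the critical angle *)

(** Up to the factor [cross u u'], [A] and [B] are the coordinates of [p] in the basis [u], [u'],
    and [C] and [D] those of [q]. All are nonnegative, so the difference in [crossE] is bounded by
    the sum [A * D + B * C] that occurs in [dotE]. *)
Lemma cone_angle (u u' p q : R * R) :
  0 < cross u u' -> 29 * cross u u' <= 15 * dot u u' ->
  0 <= cross u p -> cross u' p <= 0 -> 0 <= cross u q -> cross u' q <= 0 ->
  29 * `|cross p q| <= 15 * dot p q.
Proof.
set d := cross u u'; set A := - cross u' p; set B := cross u p.
set C := - cross u' q; set D := cross u q.
move=> d0 du B0 A0 D0 C0.
have {}A0 : 0 <= A by rewrite oppr_ge0.
have {}C0 : 0 <= C by rewrite oppr_ge0.
have crossE : d * cross p q = A * D - B * C.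
  by rewrite /d /A /B /C /D /cross; ring.
have dotE : d * (d * dot p q) =
    A * C * dot u u + B * D * dot u' u' + (A * D + B * C) * dot u u'.
  by rewrite /d /A /B /C /D /cross /dot; ring.
have AD : 0 <= A * D by rewrite mulr_ge0.
have BC : 0 <= B * C by rewrite mulr_ge0.
have sq w : 0 <= dot w w by rewrite /dot -!expr2 addr_ge0 ?sqr_ge0.
have t1 : 0 <= A * C * dot u u by rewrite !mulr_ge0.
have t2 : 0 <= B * D * dot u' u' by rewrite !mulr_ge0.
have t3 : (A * D + B * C) * (29 * d) <= (A * D + B * C) * (15 * dot u u').
  by apply: ler_wpM2l => //; rewrite addr_ge0.
have key : 29 * (A * D + B * C) <= 15 * (d * dot p q).
  by rewrite -(ler_pM2l d0); lra.
rewrite -(ler_pM2l d0) mulrCA [X in _ <= X]mulrCA.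
apply: le_trans key; rewrite ler_pM2l // -[d in d * `|_|]gtr0_norm // -normrM crossE.
by rewrite ler_norml; lra.
Qed.

(* The rays through (1,0), (2,1), (4,5), (1,5), (-1,5), (-4,5), (-2,1), (-1,0)
   cut the upper half-plane into sectors of angle at most arctan (15/29), which
   is below the threshold arccos (7/8) of the argument. *)
Definition upper_sector p : nat :=
  if cross (2, 1) p <= 0 then 0 else
  if cross (4, 5) p <= 0 then 1 else
  if cross (1, 5) p <= 0 then 2 else
  if cross (-1, 5) p <= 0 then 3 else
  if cross (-4, 5) p <= 0 then 4 else
  if cross (-2, 1) p <= 0 then 5 else 6.

Lemma upper_sector_lt p : (upper_sector p < 7)%N.
Proof. by rewrite /upper_sector; do !case: ifP => _. Qed.

Lemma upper_sector_angle p q : 0 <= p.2 -> 0 <= q.2 ->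
  upper_sector p = upper_sector q -> 29 * `|cross p q| <= 15 * dot p q.
Proof.
rewrite /upper_sector => p2 q2.
case: leP => p21; last case: leP => p45; last case: leP => p15;
  last case: leP => pm15; last case: leP => pm45; last case: leP => pm21;
(case: leP => q21; last case: leP => q45; last case: leP => q15;
  last case: leP => qm15; last case: leP => qm45; last case: leP => qm21) => // _.
- by apply: (@cone_angle (1, 0) (2, 1));
    first [by [] | exact: ltW | rewrite /cross /dot /=; lra].
- by apply: (@cone_angle (2, 1) (4, 5));
    first [by [] | exact: ltW | rewrite /cross /dot /=; lra].
- by apply: (@cone_angle (4, 5) (1, 5));
    first [by [] | exact: ltW | rewrite /cross /dot /=; lra].
- by apply: (@cone_angle (1, 5) (-1, 5));
    first [by [] | exact: ltW | rewrite /cross /dot /=; lra].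
- by apply: (@cone_angle (-1, 5) (-4, 5));
    first [by [] | exact: ltW | rewrite /cross /dot /=; lra].
- by apply: (@cone_angle (-4, 5) (-2, 1));
    first [by [] | exact: ltW | rewrite /cross /dot /=; lra].
- by apply: (@cone_angle (-2, 1) (-1, 0));
    first [by [] | exact: ltW | rewrite /cross /dot /=; lra].
Qed.

(** Points below the first axis are classified through their opposites, so that the seven upper
    sectors give fourteen in all. *)
Definition sector p : bool * 'I_7 :=
  (0 <= p.2, inord (upper_sector (if 0 <= p.2 then p else - p))).

Lemma sector_angle p q :
  sector p = sector q -> 29 * `|cross p q| <= 15 * dot p q.
Proof.
rewrite /sector; case: (leP 0 p.2) => p2; case: (leP 0 q.2) => q2 [] //;
  move=> /(congr1 val); rewrite /= !inordK ?upper_sector_lt //.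
  exact: upper_sector_angle.
rewrite (_ : cross p q = cross (- p) (- q)); last by rewrite /cross /=; ring.
rewrite (_ : dot p q = dot (- p) (- q)); last by rewrite /dot /=; ring.
by apply: upper_sector_angle; rewrite /= oppr_ge0 ltW.
Qed.

(** If two of the points [x c] were in the same sector seen from [o], [witness_angle] would apply to
    them, with the [v] that belongs to the one farther from [o]. *)
Lemma private_neighbours (T : finType) (K : {set T}) (v x : T -> R * R)
    (o : R * R) :
  {in K, forall c, sqdist o (v c) <= 1} ->
  {in K, forall c, sqdist (v c) (x c) <= 1} ->
  {in K &, forall c c', c != c' -> 1 < sqdist (v c) (x c')} ->
  {in K &, forall c c', c != c' -> 1 < sqdist (x c) (x c')} ->
  (#|K| <= 14)%N.
Proof.
move=> ov vx vx' xx'.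
rewrite (_ : 14 = #|{: bool * 'I_7}|)%N; last by rewrite card_prod card_bool card_ord.
apply: (@leq_card_in _ _ (fun c => sector (x c - o))) => c c' cK cK' /sector_angle ang.
apply: contraTeq isT => ncc'; exfalso.
have ov' d : d \in K -> dot (v d - o) (v d - o) <= 1.
  by move=> /ov; rewrite /sqdist /dot /=; lra.
have [le|/ltW le] := leP (dot (x c - o) (x c - o)) (dot (x c' - o) (x c' - o)).
  apply: (witness_angle (ov' _ cK') _ _ _ le ang); rewrite sqdist_subr.
  - exact: vx.
  - by apply: vx' => //; rewrite eq_sym.
  - exact: xx'.
apply: (witness_angle (ov' _ cK) _ _ _ le); rewrite ?sqdist_subr.
- exact: vx.
- exact: vx'.
- by apply: xx' => //; rewrite eq_sym.
rewrite (_ : dot _ _ = dot (x c - o) (x c' - o)); last by rewrite /dot; ring.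
rewrite (_ : cross _ _ = - cross (x c - o) (x c' - o)); last by rewrite /cross; ring.
by rewrite normrN.
Qed.

End Plane.

(** * Charging at a local optimum *)

Section Domination.
Variables (T : finType) (e : rel T).
Hypothesis eC : symmetric e.

(** In a unit disk graph this says that the points are at distance at most 1, also for equal
    vertices. *)
Definition cl_adj (u v : T) : bool := (u == v) || e u v.

Lemma cl_adjC u v : cl_adj u v = cl_adj v u.
Proof. by rewrite /cl_adj eq_sym eC. Qed.

Definition independent (X : {set T}) : Prop := {in X &, forall u v, ~~ e u v}.

Lemma independent_far (X : {set T}) u v :
  independent X -> u \in X -> v \in X -> u != v -> ~~ cl_adj u v.
Proof. by move=> iX uX vX nuv; rewrite /cl_adj negb_or nuv iX. Qed.

Lemma dominatingP (D : {set T}) :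
  dominating e D <-> forall v, exists2 u, u \in D & cl_adj u v.
Proof.
split=> domD v.
  have [vD|/domD[u uD evu]] := boolP (v \in D).
    by exists v; rewrite // /cl_adj eqxx.
  by exists u; rewrite // /cl_adj eC evu orbT.
move=> vD; have [u uD /orP[/eqP uv|euv]] := domD v; first by rewrite -uv uD in vD.
by exists u; rewrite // eC.
Qed.

Definition swap_in (D : {set T}) (c : T) : {set T} :=
  c |: [set x in D | ~~ e c x].

(* [X] is the outcome of a failed exchange at [c]. *)
Definition unimprovable (D : {set T}) (c : T) : Prop :=
  exists X : {set T}, [/\ swap_in D c \subset X, independent X & #|D| <= #|X|].

(** This and [private_bound] are all that the counting takes from the geometry of the plane. *)
Hypothesis star_bound : forall (o : T) (S : {set T}),
  {in S, forall u, cl_adj o u} -> {in S &, forall u v, u != v -> ~~ cl_adj u v} ->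
  #|S| <= 5.

Hypothesis private_bound : forall (o : T) (K : {set T}) (v x : T -> T),
  {in K, forall c, cl_adj o (v c)} ->
  {in K, forall c, cl_adj (v c) (x c)} ->
  {in K &, forall c c', c != c' -> ~~ cl_adj (v c) (x c')} ->
  {in K &, forall c c', c != c' -> ~~ cl_adj (x c) (x c')} ->
  #|K| <= 14.

Section Approximation.
Variables D B : {set T}.
Hypotheses (indD : independent D) (domD : dominating e D).
Hypothesis domB : dominating e B.
Hypothesis stuckD : forall c, (exists u, e c u) -> unimprovable D c.

Let domB' : forall v, exists u, (u \in B) && cl_adj u v.
Proof. by move=> v; have /dominatingP/(_ v)[u ? ?] := domB; exists u; apply/andP. Qed.

Let domD' : forall v, exists u, (u \in D) && cl_adj u v.
Proof. by move=> v; have /dominatingP/(_ v)[u ? ?] := domD; exists u; apply/andP. Qed.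

Let dom v := xchoose (domB' v).
Let dom_in v : dom v \in B. Proof. by case/andP: (xchooseP (domB' v)). Qed.
Let dom_adj v : cl_adj (dom v) v. Proof. by case/andP: (xchooseP (domB' v)). Qed.

Let wit v := xchoose (domD' v).
Let wit_in v : wit v \in D. Proof. by case/andP: (xchooseP (domD' v)). Qed.
Let wit_adj v : cl_adj (wit v) v. Proof. by case/andP: (xchooseP (domD' v)). Qed.

Let charged (d : T) : {set T} := [set x in D | dom x == d].
Let full : {set T} := [set c in B | #|charged c| == 5].

Let charged_le5 d : #|charged d| <= 5.
Proof.
apply: (@star_bound d) => [u|u v]; rewrite !inE.
  by case/andP => _ /eqP <-; apply: dom_adj.
by case/andP=> uD _ /andP[vD _]; apply: independent_far indD uD vD.
Qed.

(** By [star_bound], at most five members of [D] are in the closed neighbourhood of [c], and five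
    are already charged to [c]. *)
Let full_charged c x : c \in full -> x \in D -> cl_adj c x -> dom x = c.
Proof.
rewrite inE => /andP[_ /eqP c5] xD cx.
have le5 : #|[set y in D | cl_adj c y]| <= 5.
  apply: (@star_bound c) => [u|u v]; rewrite !inE; first by case/andP.
  by case/andP=> uD _ /andP[vD _]; apply: independent_far indD uD vD.
have sub : charged c \subset [set y in D | cl_adj c y].
  by apply/subsetP => y; rewrite !inE => /andP[-> /eqP <-]; rewrite dom_adj.
have /eqP eqC : charged c == [set y in D | cl_adj c y] by rewrite eqEcard sub c5.
by have : x \in charged c; [rewrite eqC inE xD | rewrite inE => /andP[_ /eqP]].
Qed.

(** A failed exchange yields [X] of size at least that of [D]. As the exchange removes five vertices
    and inserts one, [X] has at least four vertices outside [swap_in D c]. The existential precedes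
    the implication so that a choice can be made for all [c] at once. *)
Let fresh_ex c : exists I : {set T}, c \in full ->
  [/\ 4 <= #|I|, independent I, {in I, forall v, ~~ cl_adj c v} &
      {in I & D, forall v x, ~~ cl_adj c x -> ~~ cl_adj v x}].
Proof.
have [cF|] := boolP (c \in full); last by exists set0.
have c5 : #|charged c| = 5 by move: cF; rewrite inE => /andP[_ /eqP].
have chargedP x : (x \in charged c) = (x \in D) && cl_adj c x.
  rewrite inE; case xD: (x \in D) => //=; apply/eqP/idP => [<-|]; first exact: dom_adj.
  exact: full_charged.
(* If [c] were in [D], independence would leave it as the only member of [D] in its closed
   neighbourhood, instead of five. *)
have cD : c \notin D.
  apply/negP => cD; have : charged c \subset [set c].
    apply/subsetP => x; rewrite chargedP inE => /andP[xD].
    by apply: contraLR => ncx; apply: (independent_far indD); rewrite // eq_sym.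
  by move/subset_leq_card; rewrite c5 cards1.
have [|X [sX iX leX]] := stuckD (c := c).
  have /card_gt0P[x] : 0 < #|charged c| by rewrite c5.
  rewrite chargedP => /andP[xD /orP[/eqP cx|ecx]]; last by exists x.
  by rewrite cx xD in cD.
exists (X :\: swap_in D c) => _; split.
- have swapC : #|swap_in D c| + 5 = #|D|.+1.
    rewrite /swap_in cardsU1 inE (negPf cD) /= add1n addSn; congr _.+1.
    rewrite -c5 -(cardsID (charged c) D) addnC; congr (_ + _).
      by apply: eq_card => x; rewrite !inE; case: (x \in D).
    apply: eq_card => x; rewrite !inE -[(x \in D) && _]/(_ && _).
    have := chargedP x; rewrite inE => ->; case xD: (x \in D) => //=.
    rewrite /cl_adj negb_or; case: (eqVneq c x) => [cx|_]; first by rewrite cx xD in cD.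
    by rewrite ?andbT.
  by rewrite cardsD (setIidPr sX); lia.
- by move=> u v; rewrite !inE => /andP[_ uX] /andP[_ vX]; apply: iX.
- move=> v /setDP[vX nv]; apply: (independent_far iX) => //.
    by apply: (subsetP sX); rewrite !inE eqxx.
  by apply: contraNneq nv => <-; rewrite !inE eqxx.
- move=> v x /setDP[vX nv] xD; rewrite /cl_adj negb_or => /andP[ncx necx].
  have xS : x \in swap_in D c by rewrite !inE xD necx orbT.
  apply: (independent_far iX) => //; first exact: (subsetP sX).
  by apply: contraNneq nv => ->.
Qed.

(** * Counting the deficits *)

Lemma local_optimum_bound : 9 * #|D| <= 43 * #|B|.
Proof.
have [fresh freshP] : exists fresh : T -> {set T}, forall c, c \in full ->
  [/\ 4 <= #|fresh c|, independent (fresh c),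
      {in fresh c, forall v, ~~ cl_adj c v} &
      {in fresh c & D, forall v x, ~~ cl_adj c x -> ~~ cl_adj v x}].
  exact: (fin_all_exists fresh_ex).
pose seen c d := [set v in fresh c | dom v == d].
have seen_le c d : c \in full -> #|seen c d| + #|charged d| <= 5.
  move=> cF; have [_ iI nI farI] := freshP c cF.
  (* If [x] were near [c], it would be charged to [c], making [d] equal to [c]; but [d] dominates
     [v] and [c] does not. *)
  have far v x : v \in seen c d -> x \in charged d -> ~~ cl_adj v x.
    rewrite !inE => /andP[vI /eqP vd] /andP[xD /eqP xd].
    apply: farI => //; apply/negP => cx.
    by have := nI v vI; rewrite -(full_charged cF xD cx) xd -vd dom_adj.
  have dis : [disjoint seen c d & charged d].
    apply/pred0P => x /=; apply/negP => /andP[h1 h2].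
    by have := far _ _ h1 h2; rewrite /cl_adj eqxx.
  rewrite -(leq_card_setU _ _).2 // in dis.
  have <- : #|seen c d :|: charged d| = #|seen c d| + #|charged d| by apply/eqP.
  apply: (@star_bound d) => [u|u v]; rewrite !in_setU.
    by rewrite !inE => /orP[] /andP[_ /eqP <-]; apply: dom_adj.
  case/orP=> hu /orP[] hv nuv.
  - by move: hu hv; rewrite !inE => /andP[hu _] /andP[hv _];
    apply: independent_far iI hu hv _.
  - exact: far.
  - by rewrite cl_adjC far.
  - by move: hu hv; rewrite !inE => /andP[hu _] /andP[hv _];
    apply: independent_far indD hu hv _.
have seers_le d : #|[set c in full | seen c d != set0]| <= 14.
  pose v c := odflt d [pick v in seen c d].
  have vP c : c \in [set c in full | seen c d != set0] ->
      [/\ c \in full, v c \in fresh c & dom (v c) = d].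
    rewrite inE => /andP[cF /set0Pn[u uS]]; rewrite /v.
    case: pickP => [y|/(_ u)]; last by rewrite uS.
    by move=> /= /setIdP[yI /eqP yd]; split.
  (* A member of [D] near [v c] must be near [c], hence charged to [c]. It therefore determines [c],
     and is far from the [v] of any other full vertex. *)
  have xP c : c \in [set c in full | seen c d != set0] -> dom (wit (v c)) = c.
    move=> /vP[cF vI _]; have [_ _ _ farI] := freshP c cF.
    apply: full_charged => //; apply/negP => /negP nc.
    by have := farI _ _ vI (wit_in (v c)) nc; rewrite cl_adjC wit_adj.
  apply: (@private_bound d _ v (wit \o v)) => [c|c|c c'|c c'] /=.
  - by case/vP => _ _ <-; apply: dom_adj.
  - by move=> _; rewrite cl_adjC wit_adj.
  - move=> cS cS' ncc'; have [cF vI _] := vP _ cS.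
    have [_ _ _ farI] := freshP c cF; apply: farI => //.
    apply/negP => cx; move/eqP: ncc'; apply.
    by rewrite -(xP _ cS') (full_charged cF _ cx).
  - move=> cS cS' ncc'; apply: (independent_far indD) => //.
    by apply: contraNneq ncc' => eqw; rewrite -(xP _ cS) eqw xP.
(* Double counting of the fresh vertices: every full [c] has at least four, and each [d] dominates
   at most its deficit of them, for at most 14 vertices [c]. *)
have count1 : 4 * #|full| <= \sum_(d in B) 14 * (5 - #|charged d|).
  apply: (@leq_trans (\sum_(c in full) \sum_(d in B) #|seen c d|)).
    rewrite mulnC -sum_nat_const; apply: leq_sum => c cF.
    have [le4 _ _ _] := freshP c cF; apply: leq_trans le4 _.
    rewrite -sum1_card (partition_big dom (mem B)) /=; last by move=> v _; apply: dom_in.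
    by apply: leq_sum => d _; rewrite -sum1_card; apply: eq_leq;
      apply: eq_bigl => v; rewrite inE.
  rewrite exchange_big /=; apply: leq_sum => d dB.
  apply: (@leq_trans (\sum_(c in full | seen c d != set0) (5 - #|charged d|))).
    rewrite [X in _ <= X]big_mkcondr /=; apply: leq_sum => c cF.
    case: eqP => [->|_] /=; first by rewrite cards0.
    by rewrite leq_subRL ?charged_le5 // addnC; apply: seen_le.
  rewrite sum_nat_const leq_mul2r; apply/orP; right.
  by have := seers_le d; rewrite cardsE.
(* A member of [B] without deficit is fully charged. *)
have count2 : #|B| <= \sum_(d in B) (5 - #|charged d|) + #|full|.
  have -> : #|full| = \sum_(d in B) (#|charged d| == 5).
    by rewrite -sum1_card big_mkcond /= [RHS]big_mkcond; apply: eq_bigr => d _;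
       rewrite inE; case: (d \in B) => //; case: eqP.
  rewrite -big_split /= -sum1_card; apply: leq_sum => d _.
  by have := charged_le5 d; lia.
have count3 : #|D| + \sum_(d in B) (5 - #|charged d|) = 5 * #|B|.
  have -> : #|D| = \sum_(d in B) #|charged d|.
    rewrite -sum1_card (partition_big dom (mem B)) /=; last by move=> v _; apply: dom_in.
    by apply: eq_bigr => d _; rewrite -sum1_card; apply: eq_bigl => v; rewrite inE.
  rewrite -big_split mulnC -sum_nat_const /=; apply: eq_bigr => d _.
  by have := charged_le5 d; lia.
(* By [count1], [#|full|] is at most 7/2 of the total deficit, so [#|B|] is at most 9/2 of it by
   [count2], and [count3] gives 5 - 2/9 = 43/9. *)
rewrite -big_distrr /= in count1.
by lia.
Qed.

End Approximation.
End Domination.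

(** * The two packing bounds in unit disk graphs *)

Section UnitDisk.
Variables (R : realType) (T : finType) (e : rel T).
Hypothesis udg : unit_disk_graph R e.

Let place : exists p : T -> R * R,
  forall u v, cl_adj e u v = (sqdist (p u) (p v) <= 1)%R.
Proof.
have [_ [p pP]] := udg; exists p => u v; rewrite /cl_adj.
case: eqVneq => [->|nuv] /=; last by rewrite pP // euclidean_dist_le1.
by rewrite /sqdist !subrr expr0n addr0 ler01.
Qed.

Lemma unit_disk_star_bound (o : T) (S : {set T}) :
  {in S, forall u, cl_adj e o u} ->
  {in S &, forall u v, u != v -> ~~ cl_adj e u v} -> #|S| <= 5.
Proof.
have [p pP] := place => in_o far; apply: (@independent_in_disk _ _ S p (p o)).
  by move=> u /in_o; rewrite pP.
by move=> u v uS vS nuv; rewrite ltNge -pP far.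
Qed.

Lemma unit_disk_private_bound (o : T) (K : {set T}) (v x : T -> T) :
  {in K, forall c, cl_adj e o (v c)} ->
  {in K, forall c, cl_adj e (v c) (x c)} ->
  {in K &, forall c c', c != c' -> ~~ cl_adj e (v c) (x c')} ->
  {in K &, forall c c', c != c' -> ~~ cl_adj e (x c) (x c')} ->
  #|K| <= 14.
Proof.
have [p pP] := place => ov vx vx' xx'.
apply: (@private_neighbours _ _ K (p \o v) (p \o x) (p o)) => [c|c|c c'|c c'] /=.
- by move=> /ov; rewrite pP.
- by move=> /vx; rewrite pP.
- by move=> cK cK' ncc'; rewrite ltNge -pP vx'.
- by move=> cK cK' ncc'; rewrite ltNge -pP xx'.
Qed.

Theorem unit_disk_local_optimum (D B : {set T}) :
  independent e D -> dominating e D -> dominating e B ->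
  (forall c, (exists u, e c u) -> unimprovable e D c) ->
  9 * #|D| <= 43 * #|B|.
Proof.
have [[eC eI] _] := udg.
exact: (local_optimum_bound eC unit_disk_star_bound unit_disk_private_bound).
Qed.

End UnitDisk.

(** * The program *)

Section Logic.
Variable w : nat.

(** The cost is only bounded from above, so that branches of different cost can share a bound. *)
Definition runs (c : cmd) (s : state) (T : nat) (Q : state -> Prop) : Prop :=
  exists s' t, [/\ exec w c s s' t, t <= T & Q s'].

Lemma runs_weaken c s T T' (Q Q' : state -> Prop) :
  runs c s T Q -> T <= T' -> (forall s', Q s' -> Q' s') -> runs c s T' Q'.
Proof.
move=> [s' [t [ex le q]]] leT sub; exists s', t; split => //.
  exact: leq_trans leT.
exact: sub.
Qed.

Lemma runs_skip s (Q : state -> Prop) : Q s -> runs Skip s 1 Q.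
Proof. by move=> q; exists s, 1; split=> //; constructor. Qed.

Lemma runs_assign x b s (Q : state -> Prop) :
  Q (set_var s x (eval w s b)) -> runs (Assign x b) s (expr_cost b).+1 Q.
Proof. by move=> q; do 2!eexists; split; [constructor | | exact: q]. Qed.

Lemma runs_reset x s (Q : state -> Prop) :
  Q (set_var s x 0) -> runs (Assign x (Const 0)) s 2 Q.
Proof. by move=> q; apply: runs_assign; rewrite /= mod0n. Qed.

Lemma runs_put a i b s (Q : state -> Prop) :
  Q (set_arr s a (eval w s i) (eval w s b)) ->
  runs (Put a i b) s (expr_cost i + expr_cost b).+1 Q.
Proof. by move=> q; do 2!eexists; split; [constructor | | exact: q]. Qed.

Lemma runs_seq c1 c2 s T1 T2 (Q1 Q : state -> Prop) :
  runs c1 s T1 Q1 -> (forall s', Q1 s' -> runs c2 s' T2 Q) ->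
  runs (Seq c1 c2) s (T1 + T2) Q.
Proof.
move=> [s1 [t1 [ex1 le1 q1]]] /(_ _ q1) [s2 [t2 [ex2 le2 q2]]].
by exists s2, (t1 + t2); split=> //; [apply: exec_seq ex1 ex2 | apply: leq_add].
Qed.

Lemma runs_if b c1 c2 s T (Q : state -> Prop) :
  runs (if eval w s b != 0 then c1 else c2) s T Q ->
  runs (If b c1 c2) s (expr_cost b + T).+1 Q.
Proof.
move=> [s' [t [ex le q]]]; exists s', (expr_cost b + t).+1.
by split; [constructor | rewrite ltnS leq_add2l |].
Qed.

Definition For (i : nat) (E : expr) (body : cmd) : cmd :=
  While (Bin Lt (Var i) E)
    (Seq body (Assign i (Bin Add (Var i) (Const 1)))).

(** Besides the body and the evaluation of [E], a round costs 3 for the test and 4 for the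
    increment; the final test costs 3. The bound [hi < 2 ^ w] keeps the counter from wrapping
    around. *)
Lemma runs_for i E body (Inv : nat -> state -> Prop) (T : nat -> nat) lo hi s :
  lo <= hi -> hi < 2 ^ w ->
  (forall k s, lo <= k <= hi -> Inv k s -> var s i = k /\ eval w s E = hi) ->
  (forall k s, lo <= k < hi -> Inv k s ->
     runs body s (T k) (fun s' => var s' i = k /\ Inv k.+1 (set_var s' i k.+1))) ->
  Inv lo s ->
  runs (For i E body) s
    (\sum_(lo <= k < hi) (T k + expr_cost E + 7) + expr_cost E + 3) (Inv hi).
Proof.
move=> lohi hiw inv step; move hd: (hi - lo) => d.
elim: d lo lohi hd inv step s => [|d IH] lo lohi hd inv step s invs.
  have ? : lo = hi by lia.
  subst lo; have [|vi vE] := inv _ _ _ invs; first by rewrite leqnn.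
  exists s, (expr_cost (Bin Lt (Var i) E)).+1; split => //.
    by constructor; rewrite /= vi vE ltnn.
  by rewrite /=; lia.
have lt : lo < hi by lia.
have [|vi vE] := inv _ _ _ invs; first by rewrite leqnn.
have [|s1 [t1 [ex1 le1 [v1 inv1]]]] := step _ _ _ invs; first by rewrite leqnn.
have [|||s2 [t2 [ex2 le2 inv2]]] := IH lo.+1 lt _ _ _ _ inv1.
- by lia.
- by move=> k s' h; apply: inv; lia.
- by move=> k s' h; apply: step; lia.
exists s2, (expr_cost (Bin Lt (Var i) E) + (t1 + 4) + t2).+1; split => //.
  apply: exec_while_step ex2; first by rewrite /= vi vE lt.
  apply: exec_seq ex1 _.
  rewrite (_ : lo.+1 = eval w s1 (Bin Add (Var i) (Const 1))); first by constructor.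
  by rewrite /= v1 modnDmr modn_small addn1 //; lia.
by rewrite big_ltn //=; lia.
Qed.

Lemma runs_for_const i E body (Inv : nat -> state -> Prop) (T : nat) lo hi s :
  lo <= hi -> hi < 2 ^ w ->
  (forall k s, lo <= k <= hi -> Inv k s -> var s i = k /\ eval w s E = hi) ->
  (forall k s, lo <= k < hi -> Inv k s ->
     runs body s T (fun s' => var s' i = k /\ Inv k.+1 (set_var s' i k.+1))) ->
  Inv lo s ->
  runs (For i E body) s
    ((hi - lo) * (T + expr_cost E + 7) + expr_cost E + 3) (Inv hi).
Proof.
move=> lohi hiw inv step inv0.
have := @runs_for i E body Inv (fun=> T) lo hi s lohi hiw inv step inv0.
by rewrite sum_nat_const_nat.
Qed.

End Logic.

Lemma nth_flatten_offset (A : Type) (x0 : A) (ss : seq (seq A)) k i :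
  i < size (nth [::] ss k) ->
  nth x0 (flatten ss) (sumn (take k (shape ss)) + i) = nth x0 (nth [::] ss k) i.
Proof.
elim: ss k => [|s ss IH] [|k] //=; first by move=> lt; rewrite nth_cat lt.
by move=> lt; rewrite nth_cat -addnA ltnNge leq_addr /= addKn IH.
Qed.

(** * The local search program *)

Definition succ (x : expr) := Bin Add x (Const 1).

(* Variables: 0 holds n, 1 the flag telling that the last pass improved the set,
   2 the candidate c, 3 and 4 are loop counters, 5 a boolean, 6 and 7 sizes, and
   8 the length of the output.  Array 2 is the current set and array 3 the
   candidate set, both as characteristic functions. *)

Definition copy (a b : nat) : cmd :=
  Seq (Assign 3 (Const 0)) (For 3 (Var 0) (Put b (Var 3) (Get a (Var 3)))).

(** Comparing with 0 after each addition keeps variable 5 a bit, whatever the length of the list. *)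
Definition scan (a : nat) : cmd :=
  Seq (Assign 5 (Get a (Var 3)))
  (Seq (Assign 4 (Get 0 (Var 3)))
    (For 4 (Get 0 (succ (Var 3)))
      (Assign 5 (Bin Lt (Const 0) (Bin Add (Var 5) (Get a (Get 1 (Var 4)))))))).

(** Greedy extension to a maximal independent set. *)
Definition complete (a : nat) : cmd :=
  Seq (Assign 3 (Const 0))
    (For 3 (Var 0)
      (Seq (scan a) (If (Var 5) Skip (Put a (Var 3) (Const 1))))).

Definition swap : cmd :=
  Seq (Assign 4 (Get 0 (Var 2)))
  (Seq (For 4 (Get 0 (succ (Var 2))) (Put 3 (Get 1 (Var 4)) (Const 0)))
    (Put 3 (Var 2) (Const 1))).

Definition count (a x : nat) : cmd :=
  Seq (Assign x (Const 0))
  (Seq (Assign 3 (Const 0))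
    (For 3 (Var 0) (Assign x (Bin Add (Var x) (Get a (Var 3)))))).

(** The exchange is tried on a copy and takes effect only if the completed result is strictly
    smaller. *)
Definition attempt : cmd :=
  Seq (copy 2 3) (Seq swap (Seq (complete 3) (Seq (count 3 6) (Seq (count 2 7)
    (If (Bin Lt (Var 6) (Var 7)) (Seq (copy 3 2) (Assign 1 (Const 1))) Skip))))).

(** Vertices with an empty list are skipped, so that the number of attempts is also bounded by the
    total length of the lists. *)
Definition pass : cmd :=
  Seq (Assign 2 (Const 0))
    (For 2 (Var 0)
      (If (Bin Lt (Get 0 (Var 2)) (Get 0 (succ (Var 2)))) attempt Skip)).

Definition improve : cmd :=
  Seq (Assign 1 (Const 1)) (While (Var 1) (Seq (Assign 1 (Const 0)) pass)).

(** The offsets in array 0 may be overwritten, being no longer read; variable 0 changes last because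
    it bounds the loop. *)
Definition output : cmd :=
  Seq (Assign 8 (Const 0))
  (Seq (Assign 3 (Const 0))
  (Seq (For 3 (Var 0)
         (If (Get 2 (Var 3))
           (Seq (Put 0 (Var 8) (Var 3)) (Assign 8 (succ (Var 8)))) Skip))
    (Assign 0 (Var 8)))).

Definition local_search : cmd := Seq (complete 2) (Seq improve output).

(** * Correctness and running time of the routines *)

Section Program.
Variables (n : nat) (e : rel 'I_n) (L : 'I_n -> seq 'I_n) (w : nat).
Hypothesis eC : symmetric e.
Hypothesis eI : irreflexive e.
Hypothesis adjL : adjacency_lists e L.

Definition nb_arcs := adj_offset L n.
Local Notation M := nb_arcs.

Hypothesis fit : n + M + 4 < 2 ^ w.

Lemma mod_word x : x <= n + M + 4 -> x %% 2 ^ w = x.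
Proof. by move=> le; rewrite modn_small //; apply: leq_ltn_trans le fit. Qed.

Lemma eval_succ s x : eval w s x <= n + M -> eval w s (succ x) = (eval w s x).+1.
Proof. by move=> le; rewrite /= modnDmr mod_word addn1 //; lia. Qed.

Lemma adj_offsetS (v : 'I_n) : adj_offset L v.+1 = adj_offset L v + size (L v).
Proof.
rewrite /adj_offset (bigD1 v) //= addnC; congr (_ + _); apply: eq_bigl => u.
by rewrite ltnS [in RHS]ltn_neqAle andbC.
Qed.

Lemma adj_offset0 : adj_offset L 0 = 0.
Proof. by rewrite /adj_offset big_pred0. Qed.

Lemma adj_offset_mono i j : i <= j -> adj_offset L i <= adj_offset L j.
Proof.
move=> ij; rewrite /adj_offset [X in X <= _]big_mkcond [X in _ <= X]big_mkcond.
apply: leq_sum => u _; case: ltnP => // ui; rewrite (leq_trans ui ij) //.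
Qed.

Lemma adj_offset_le i : i <= n -> adj_offset L i <= M.
Proof. exact: adj_offset_mono. Qed.

Lemma nth_adj_concat (v : 'I_n) j :
  adj_offset L v <= j < adj_offset L v.+1 ->
  nth 0 (adj_concat L) j = nth v (L v) (j - adj_offset L v).
Proof.
rewrite adj_offsetS => /andP[le lt].
set ss := [seq [seq val u | u <- L v] | v <- enum 'I_n].
have nthss (u : 'I_n) : nth [::] ss u = [seq val x | x <- L u].
  by rewrite (nth_map u) ?size_enum_ord ?nth_ord_enum.
have szss : size ss = n by rewrite size_map size_enum_ord.
have szsh : size (shape ss) = n by rewrite /shape size_map.
have offE : adj_offset L v = sumn (take v (shape ss)).
  have : v <= n by apply: ltnW.
  elim: (val v) => [|k IH] kn; first by rewrite take0 adj_offset0.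
  rewrite (take_nth 0) ?szsh // sumn_rcons -IH ?(ltnW kn) //.
  rewrite (adj_offsetS (Ordinal kn)); congr (_ + _).
  by rewrite (nth_map [::]) ?szss // (nthss (Ordinal kn)) size_map.
have lt' : j - adj_offset L v < size (L v) by rewrite ltn_subLR.
rewrite /adj_concat -/ss -{1}(subnKC le) {1}offE nth_flatten_offset nthss.
  by rewrite (nth_map v).
by rewrite size_map.
Qed.

Definition ready (s : state) : Prop :=
  [/\ var s 0 = n, arr s 0 = arr (input_state L) 0
    & arr s 1 = arr (input_state L) 1].

Definition flags (s : state) (a : nat) (X : {set 'I_n}) : Prop :=
  forall v : 'I_n, arr s a v = (v \in X).

Lemma ready_offset s i : ready s -> i <= n -> arr s 0 i = adj_offset L i.
Proof. by move=> [_ -> _] /= ->. Qed.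

(** Frame condition for a routine working on array [a]; variables 0 to 2 hold [n], the flag and the
    candidate. *)
Definition keeps (a : nat) (s s' : state) : Prop :=
  (forall x, x <= 2 -> var s' x = var s x) /\
  (forall b, b != a -> arr s' b = arr s b).

Lemma keeps_ready a s s' : 1 < a -> keeps a s s' -> ready s -> ready s'.
Proof.
move=> a1 [kv ka] [v0 a0 a1']; split; rewrite ?kv ?ka //; case: a a1 {ka} => [|[]] //.
Qed.

Lemma keeps_trans a s s' s'' : keeps a s s' -> keeps a s' s'' -> keeps a s s''.
Proof.
by move=> [kv ka] [kv' ka']; split => x hx; rewrite ?kv' ?kv ?ka' ?ka.
Qed.

Lemma keeps_set_var a s s' x v :
  2 < x -> keeps a s s' -> keeps a s (set_var s' x v).
Proof.
move=> x2 ks; apply: keeps_trans ks _; split=> // y y2.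
by rewrite /= /upd; case: eqP => // yx; rewrite yx leqNgt x2 in y2.
Qed.

Lemma keeps_set_arr a s s' i v : keeps a s s' -> keeps a s (set_arr s' a i v).
Proof.
move=> ks; apply: keeps_trans ks _; split=> // b ba.
by rewrite /= /upd (negPf ba).
Qed.

Lemma keeps_flags a b s s' X : keeps a s s' -> b != a -> flags s b X -> flags s' b X.
Proof. by move=> [_ ka] ba fl v; rewrite ka. Qed.

Lemma runs_copy a b s X : 1 < b -> a != b -> ready s -> flags s a X ->
  runs w (copy a b) s (20 * n + 20) (fun s' => keeps b s s' /\ flags s' b X).
Proof.
move=> b1 ab rs fl.
pose Inv k s' := [/\ keeps b s s', var s' 3 = k &
  forall v : 'I_n, v < k -> arr s' b v = (v \in X)].
apply: runs_weaken.
- apply: (runs_seq (Q1 := Inv 0)).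
    by apply: runs_reset; split=> //; apply: keeps_set_var.
  move=> s1 i1;
    apply: (runs_for_const (Inv := Inv) (T := 4) (lo := 0) (hi := n)) i1 => //.
  + by lia.
  + move=> k s' _ [ks v3 _]; split=> //=.
    by have [] := keeps_ready b1 ks rs.
  + move=> k s' /andP[_ kn] [ks v3 fX]; apply: runs_put; split=> //.
    split=> //; first by apply: keeps_set_var => //; apply: keeps_set_arr.
    move=> v; rewrite ltnS leq_eqVlt /= /upd eqxx v3 => /orP[/eqP vk|vk].
      by rewrite vk eqxx ks.2 // -vk fl.
    by rewrite (ltn_eqF vk) fX.
- by rewrite /=; lia.
- by move=> s' [ks _ fX]; split=> // v; apply: fX.
Qed.

Lemma runs_count a x s X : 5 < x -> ready s -> flags s a X ->
  runs w (count a x) s (20 * n + 20) (fun s' =>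
    [/\ arr s' = arr s, forall y, y != 3 -> y != x -> var s' y = var s y
      & var s' x = #|X|]).
Proof.
move=> x5 rs fl.
have x3 : (3 == x) = false by lia.
have x0 : (0 == x) = false by lia.
pose Inv k s' := [/\ arr s' = arr s, forall y, y != 3 -> y != x -> var s' y = var s y,
  var s' 3 = k & var s' x = \sum_(v < n | v < k) (v \in X)].
have leX k : \sum_(v < n | v < k) (v \in X) <= n.
  rewrite -[X in _ <= X](card_ord n) -sum1_card big_mkcond /=.
  by apply: leq_sum => v _; case: ifP => //; case: (v \in X).
apply: runs_weaken.
- apply: runs_seq.
    apply: runs_reset; exact: (erefl (set_var s x 0)).
  move=> s1 <-; apply: (runs_seq (Q1 := Inv 0)).
    apply: runs_reset; split=> //=.
    + by move=> y y3 yx; rewrite /upd (negPf y3) (negPf yx).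
    + by rewrite /upd eq_sym x3 eqxx big_pred0.
  move=> s2 i2;
    apply: (runs_for_const (Inv := Inv) (T := 5) (lo := 0) (hi := n)) i2 => //.
  + by lia.
  + move=> k s' _ [as' kv v3 _]; split=> //=.
    by rewrite kv ?x0 //; case: rs.
  + move=> k s' /andP[_ kn] [as' kv v3 vx]; apply: runs_assign => /=.
    split; first by rewrite /upd x3.
    split=> //=.
    * by move=> y y3 yx; rewrite /upd (negPf y3) (negPf yx) kv.
    * rewrite /upd eq_sym x3 eqxx v3 as' vx (fl (Ordinal kn)) mod_word.
        rewrite [RHS](bigD1 (Ordinal kn)) //= addnC; congr (_ + _).
        by apply: eq_bigl => u; rewrite ltnS [in LHS]ltn_neqAle andbC -val_eqE.
      by have := leX k; case: (_ \in X) => /=; lia.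
- by rewrite /=; lia.
- move=> s' [as' kv _ vx]; split=> //; rewrite vx -sum1_card [RHS]big_mkcond.
  by apply: eq_big => [v|v _]; rewrite ?ltn_ord //; case: (v \in X).
Qed.

Lemma runs_scan a s (v : 'I_n) X : ready s -> flags s a X -> var s 3 = v ->
  runs w (scan a) s (20 * (adj_offset L v.+1 - adj_offset L v) + 20) (fun s' =>
    [/\ arr s' = arr s, forall x, x <= 3 -> var s' x = var s x
      & var s' 5 = (v \in X) || has (mem X) (L v)]).
Proof.
move=> rs fl v3.
pose Inv j s' := [/\ arr s' = arr s, forall x, x <= 3 -> var s' x = var s x,
  var s' 4 = j &
  var s' 5 = (v \in X) || has (mem X) (take (j - adj_offset L v) (L v))].
have offv : adj_offset L v <= adj_offset L v.+1 by apply: adj_offset_mono.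
have off_le : adj_offset L v.+1 <= M by apply: adj_offset_le.
apply: runs_weaken.
- apply: runs_seq.
    by apply: runs_assign; exact: (erefl (set_var s 5 (eval w s (Get a (Var 3))))).
  move=> s1 <-; apply: (runs_seq (Q1 := Inv (adj_offset L v))).
    apply: runs_assign; split=> //=.
    + by move=> x x3; rewrite /upd !ifN //; apply: contraTneq x3 => ->.
    + by rewrite /upd /= v3 ready_offset // ltnW.
    + by rewrite /upd /= v3 fl subnn take0 orbF.
  move=> s2 i2;
    apply: (runs_for_const (Inv := Inv) (T := 8) (lo := adj_offset L v)
    (hi := adj_offset L v.+1)) i2 => //.
  + by lia.
  + move=> k s' _ [as' kv v4 _]; split=> //.
    have -> : eval w s' (Get 0 (succ (Var 3))) = arr s' 0 (eval w s' (succ (Var 3))).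
      by [].
    have v3' : var s' 3 = v by rewrite kv.
    have vn := ltn_ord v.
    by rewrite eval_succ; [rewrite /= v3' as' ready_offset
      | rewrite /= v3' (leq_trans (ltnW vn)) ?leq_addr].
  + move=> k s' /andP[le lt] [as' kv v4 v5]; apply: runs_assign; split=> //.
    split=> //.
    * by move=> x x3 /=; rewrite /upd !ifN ?kv //; apply: contraTneq x3 => ->.
    * have lt' : k - adj_offset L v < size (L v).
        by rewrite ltn_subLR // -adj_offsetS.
      have [_ _ a1] := rs.
      rewrite /= /upd /= v5 v4 as' a1 /= (nth_adj_concat (v := v)) ?le // fl.
      rewrite subSn // (take_nth v) // has_rcons mod0n /=.
      have bits (b b' : bool) : (b + b') %% 2 ^ w = b + b'.
        by apply: mod_word; case: b; case: b' => /=; lia.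
      rewrite bits; by case: (v \in X); case: (has _ _); case: (_ \in X).
- by rewrite /=; lia.
- move=> s' [as' kv _ ->]; split=> //.
  by rewrite adj_offsetS addKn take_size.
Qed.

Lemma adj_scan (v : 'I_n) (X : {set 'I_n}) :
  (v \in X) || has (mem X) (L v) = [exists u in X, cl_adj e u v].
Proof.
have mL := (adjL v).2.
apply/idP/existsP => [/orP[vX|/hasP[u uL uX]]|[u /andP[uX /orP[/eqP uv|euv]]]].
- by exists v; rewrite vX /cl_adj eqxx.
- exists u; rewrite [u \in X]uX /cl_adj eC.
  by have := mL u; rewrite uL unfold_in => <-; rewrite orbT.
- by rewrite -uv uX.
- by apply/orP; right; apply/hasP; exists u => //; rewrite mL unfold_in /= eC.
Qed.

(** A vertex passed over is dominated, an inserted one dominates itself, and this persists as the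
    set grows. A round costs time linear in the degree, so the costs telescope to [M]. *)
Lemma runs_complete a s X :
  1 < a -> ready s -> flags s a X -> independent e X ->
  runs w (complete a) s (60 * n + 20 * M + 60) (fun s' => keeps a s s' /\
    exists X', [/\ flags s' a X', X \subset X', independent e X' & dominating e X']).
Proof.
move=> a1 rs fl iX.
pose Inv k s' := [/\ keeps a s s', var s' 3 = k & exists X',
  [/\ flags s' a X', X \subset X', independent e X'
    & forall v : 'I_n, v < k -> [exists u in X', cl_adj e u v]]].
pose T k := 20 * (adj_offset L k.+1 - adj_offset L k) + 25.
apply: runs_weaken.
- apply: (runs_seq (Q1 := Inv 0)).
    apply: runs_reset; split=> //; first exact: keeps_set_var.
    by exists X.
  move=> s1 i1; apply: (runs_for (Inv := Inv) (T := T) (lo := 0) (hi := n)) i1 => //.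
  + by lia.
  + by move=> k s' _ [ks v3 _]; split=> //=; have [] := keeps_ready a1 ks rs.
  + move=> k s' /andP[_ kn] [ks v3 [X' [fl' XX' iX' domX']]].
    have rs' := keeps_ready a1 ks rs; pose v := Ordinal kn.
    rewrite /T (_ : 25 = 20 + 5) // addnA.
    apply: runs_seq; first exact: (runs_scan (v := v) rs' fl' v3).
    move=> s2 [as2 kv2 v5].
    have ks2 : keeps a s s2.
      apply: keeps_trans ks _; split=> [x x2|b _]; last by rewrite as2.
      by rewrite kv2 // ltnW.
    have v32 : var s2 3 = k by rewrite kv2.
    have flg : flags s2 a X' by move=> u; rewrite as2.
    apply: (runs_weaken (T := 5));
      [apply: (runs_if (T := 3)) | by [] | by move=> ? h; exact: h].
    rewrite /= v5 adj_scan; case: ifP => /=.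
      rewrite eqb0 negbK => ex.
      apply: (runs_weaken (T := 1));
        [apply: runs_skip | by [] | by move=> ? h; exact: h].
      split=> //; split=> //; first exact: keeps_set_var.
      exists X'; split=> // u; rewrite ltnS leq_eqVlt => /orP[/eqP uk|];
        last exact: domX'.
      by have -> : u = v by apply: val_inj.
    move/negbT; rewrite negbK eqb0 => nex; apply: runs_put.
    split=> //; split=> //.
      by apply: keeps_set_var => //; apply: keeps_set_arr.
    have far u : u \in X' -> ~~ cl_adj e u v.
      by move=> uX; apply: contraNN nex => h; apply/existsP; exists u; rewrite uX.
    exists (v |: X'); split.
    * move=> u; rewrite /= /upd eqxx v32 !inE -val_eqE /=.
      by case: eqP => _ /=; rewrite ?mod_word ?flg //; lia.
    * exact: subset_trans (subsetUr _ _).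
    * move=> x y; rewrite !inE => /orP[/eqP->|xX] /orP[/eqP->|yX].
      - by rewrite eI.
      - by have := far _ yX; rewrite /cl_adj negb_or eC => /andP[].
      - by have := far _ xX; rewrite /cl_adj negb_or => /andP[].
      - exact: iX'.
    * move=> u; rewrite ltnS leq_eqVlt => /orP[/eqP uk|uk].
        have -> : u = v by apply: val_inj.
        by apply/existsP; exists v; rewrite !inE /cl_adj !eqxx.
      have /existsP[x /andP[xX cx]] := domX' u uk.
      by apply/existsP; exists x; rewrite !inE xX orbT.
- rewrite big_split /= big_split /= /T big_split /= -big_distrr /=.
  rewrite telescope_sumn; last by move=> i j; apply: adj_offset_mono.
  by rewrite !sum_nat_const_nat adj_offset0 -/M; lia.
- move=> s' [ks _ [X' [fl' XX' iX' domX']]]; split=> //; exists X'; split=> //.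
  apply/dominatingP => // v; have /existsP[u /andP[uX cu]] := domX' v (ltn_ord v).
  by exists u.
Qed.

Lemma runs_swap s (c : 'I_n) D : ready s -> flags s 3 D -> var s 2 = c ->
  runs w swap s (20 * M + 20) (fun s' => keeps 3 s s' /\ flags s' 3 (swap_in e D c)).
Proof.
move=> rs fl v2.
pose Inv j s' := [/\ keeps 3 s s', var s' 4 = j &
  flags s' 3 [set x in D | x \notin take (j - adj_offset L c) (L c)]].
have offc : adj_offset L c <= adj_offset L c.+1 by apply: adj_offset_mono.
have off_le : adj_offset L c.+1 <= M by apply: adj_offset_le.
have r2 : 1 < 3 by [].
apply: runs_weaken; last by move=> s' h; exact: h.
- apply: (runs_seq (Q1 := Inv (adj_offset L c))).
    apply: runs_assign; split=> //=; first exact: keeps_set_var.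
    + by rewrite /upd eqxx v2 ready_offset // ltnW.
    + by move=> v; rewrite subnn take0 !inE andbT; apply: fl.
  move=> s1 i1; apply: (runs_seq (Q1 := Inv (adj_offset L c.+1))).
    apply: (runs_for_const (Inv := Inv) (T := 4) (lo := adj_offset L c)
      (hi := adj_offset L c.+1)) i1 => //.
    + by lia.
    + move=> k s' _ [ks v4 _]; split=> //.
      have -> : eval w s' (Get 0 (succ (Var 2))) = arr s' 0 (eval w s' (succ (Var 2))).
        by [].
      have v2' : var s' 2 = c by rewrite ks.1.
      have cn := ltn_ord c; have rs' := keeps_ready r2 ks rs.
      by rewrite eval_succ; [rewrite /= v2' ready_offset
      | rewrite /= v2' (leq_trans (ltnW cn)) ?leq_addr].
    + move=> k s' /andP[le lt] [ks v4 fl']; apply: runs_put; split=> //.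
      split=> //; first by apply: keeps_set_var => //; apply: keeps_set_arr.
      have lt' : k - adj_offset L c < size (L c).
        by rewrite ltn_subLR // -adj_offsetS.
      have [_ _ a1] := keeps_ready r2 ks rs.
      move=> v; rewrite /= /upd eqxx v4 a1 /= (nth_adj_concat (v := c)) ?le //.
      rewrite subSn // (take_nth c) // !inE mem_rcons inE mod0n val_eqE.
      by case: eqP => _ /=; rewrite ?andbF // fl' inE.
  move=> s2 [ks v4 fl2]; apply: runs_put; split; first exact: keeps_set_arr.
  have v2' : var s2 2 = c by rewrite ks.1.
  move=> v; rewrite /= /upd eqxx v2' val_eqE !inE; case: eqP => _ /=.
    by rewrite mod_word //; lia.
  by rewrite fl2 inE adj_offsetS addKn take_size (adjL c).2.
- by rewrite /=; lia.
Qed.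

Definition maximal_independent (D : {set 'I_n}) :=
  independent e D /\ dominating e D.

Lemma swap_in_independent D c : independent e D -> independent e (swap_in e D c).
Proof.
move=> iD x y; rewrite !inE => /orP[/eqP->|/andP[xD cx]] /orP[/eqP->|/andP[yD cy]] //.
- by rewrite eI.
- by rewrite eC.
- exact: iD.
Qed.

(** When the completed candidate is not smaller, it is itself the set that [unimprovable] asks
    for. *)
Lemma runs_attempt s (c : 'I_n) D :
  ready s -> flags s 2 D -> maximal_independent D -> var s 2 = c ->
  runs w attempt s (200 * (n + M + 1)) (fun s' =>
    [/\ ready s', var s' 2 = c & exists D', [/\ flags s' 2 D', maximal_independent D'
      & [/\ D' = D, var s' 1 = var s 1 & unimprovable e D c]
        \/ #|D'| < #|D| /\ var s' 1 = 1]]).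
Proof.
move=> rs fl [iD dD] v2.
apply: runs_weaken; last by move=> s' h; exact: h.
- apply: runs_seq; first by apply: (runs_copy (b := 3) _ _ rs fl).
  move=> s1 [k1 f1]; have rs1 := @keeps_ready 3 _ _ isT k1 rs.
  apply: runs_seq; first by apply: (runs_swap (c := c) rs1 f1); rewrite k1.1.
  move=> s2 [k2 f2]; have rs2 := @keeps_ready 3 _ _ isT k2 rs1.
  apply: runs_seq.
    by apply: (runs_complete _ rs2 f2) => //; apply: swap_in_independent.
  move=> s3 [k3 [X [f3 sX iX dX]]]; have rs3 := @keeps_ready 3 _ _ isT k3 rs2.
  have k03 := keeps_trans (keeps_trans k1 k2) k3.
  apply: runs_seq; first by apply: (runs_count (x := 6) _ rs3 f3).
  move=> s4 [a4 kv4 v64].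
  have k4 : keeps 3 s s4.
    apply: keeps_trans k03 _; split=> [x x2|b _]; last by rewrite a4.
    by apply: kv4; apply: contraTneq x2 => ->.
  have rs4 := @keeps_ready 3 _ _ isT k4 rs.
  have f42 : flags s4 2 D by apply: keeps_flags k4 _ fl.
  apply: runs_seq; first by apply: (runs_count (x := 7) _ rs4 f42).
  move=> s5 [a5 kv5 v75].
  have k5 : keeps 3 s s5.
    apply: keeps_trans k4 _; split=> [x x2|b _]; last by rewrite a5.
    by apply: kv5; apply: contraTneq x2 => ->.
  have rs5 := @keeps_ready 3 _ _ isT k5 rs.
  have f52 : flags s5 2 D by apply: keeps_flags k5 _ fl.
  have f53 : flags s5 3 X by move=> v; rewrite a5 a4 f3.
  apply: (runs_if (T := 20 * n + 20 + 2)).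
  rewrite /= v75 (kv5 6) // v64 eqb0 negbK; case: ltnP => lt.
    apply: runs_seq; first by apply: (runs_copy (b := 2) _ _ rs5 f53).
    move=> s6 [k6 f6]; have rs6 := @keeps_ready 2 _ _ isT k6 rs5.
    apply: runs_assign; split.
    + by case: rs6.
    + by rewrite /= /upd /= k6.1 // k5.1.
    exists X; split=> //; right; split=> //.
    by rewrite /= /upd /= mod_word //; lia.
  apply: (runs_weaken (T := 1));
    [apply: runs_skip | by lia | by move=> ? h; exact: h].
  split=> //; first by rewrite k5.1.
  exists D; split=> //; left; split=> //; first by rewrite k5.1.
  by exists X.
- by rewrite /=; lia.
Qed.

Definition nb_active := \sum_(0 <= k < n) (adj_offset L k < adj_offset L k.+1).

Lemma active_le_n : nb_active <= n.
Proof.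
rewrite /nb_active -[X in _ <= X]subn0 -[X in _ <= X]muln1 -sum_nat_const_nat.
by apply: leq_sum => k _; case: (_ < _).
Qed.

Lemma active_le_arcs : nb_active <= M.
Proof.
rewrite -[M]subn0 -adj_offset0 -[M]/(adj_offset L n).
rewrite -telescope_sumn; last by move=> i j; apply: adj_offset_mono.
by apply: leq_sum => k _; case: ltnP => //=; rewrite subn_gt0.
Qed.

Definition stable (D : {set 'I_n}) : Prop :=
  forall c, (exists u, e c u) -> unimprovable e D c.

Definition pass_cost := 30 * n + 200 * (n + M + 1) * nb_active + 30.

(** If the flag stays 0, the set never changed, so all failed exchanges of the pass concern the same
    [D]. *)
Lemma runs_pass s D :
  ready s -> flags s 2 D -> maximal_independent D -> var s 1 = 0 ->
  runs w pass s pass_cost (fun s' => ready s' /\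
    exists D', [/\ flags s' 2 D', maximal_independent D'
      & [/\ D' = D, var s' 1 = 0 & stable D] \/ #|D'| < #|D| /\ var s' 1 = 1]).
Proof.
move=> rs fl mD v1.
pose Inv k s' := [/\ ready s', var s' 2 = k &
  exists D', [/\ flags s' 2 D', maximal_independent D'
      & [/\ D' = D, var s' 1 = 0
          & forall c : 'I_n, c < k -> (exists u, e c u) -> unimprovable e D c]
        \/ #|D'| < #|D| /\ var s' 1 = 1]].
pose A := 200 * (n + M + 1).
pose T k := 9 + A * (adj_offset L k < adj_offset L k.+1).
apply: runs_weaken.
- apply: (runs_seq (Q1 := Inv 0)).
    by apply: runs_reset; split=> //; exists D; split=> //; left.
  move=> s1 i1; apply: (runs_for (Inv := Inv) (T := T) (lo := 0) (hi := n)) i1 => //.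
  + by lia.
  + by move=> k s' _ [[v0 _ _] v2 _].
  + move=> k s' /andP[_ kn] [rs' v2 [D' [fl' mD' cases]]].
    pose c := Ordinal kn.
    apply: (runs_weaken
      (T := (7 + (1 + A * (adj_offset L k < adj_offset L k.+1))).+1));
      [apply: runs_if | by rewrite /T; lia | by move=> ? h; exact: h].
    have -> : eval w s' (Bin Lt (Get 0 (Var 2)) (Get 0 (succ (Var 2)))) =
        (adj_offset L k < adj_offset L k.+1).
      rewrite -(ready_offset rs' (ltnW kn)) -(ready_offset rs' kn).
      have -> : k.+1 = eval w s' (succ (Var 2)).
        rewrite eval_succ /= ?v2 //.
        by apply: leq_trans (ltnW kn) _; apply: leq_addr.
      by rewrite -{1}v2.
    rewrite eqb0 negbK; case: ltnP => deg.
      have att := @runs_attempt s' c D' rs' fl' mD' v2.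
      apply: runs_weaken att _ _; first by rewrite -/A; lia.
      move=> s2 [rs2 v22 [D2 [fl2 mD2 cases2]]]; split=> //.
      split=> //; exists D2; split=> //.
      case: cases2 => [[eqD v12 uD2]|[lt2 v12]].
        case: cases => [[eqD' v11 stb]|[lt1 v11]]; last first.
          by right; rewrite eqD; split=> //; rewrite /= /upd /= v12.
        left; split; [by rewrite eqD | by rewrite /= /upd /= v12 | move=> x].
        rewrite ltnS leq_eqVlt => /orP[/eqP xk|]; last exact: stb.
        by have -> : x = c by [apply: val_inj]; rewrite -eqD'.
      right; split=> //; case: cases => [[eqD' _ _]|[lt1 _]]; first by rewrite -eqD'.
      exact: ltn_trans lt2 lt1.
    apply: (runs_weaken (T := 1));
      [apply: runs_skip | by lia | by move=> ? h; exact: h].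
    split=> //; split=> //; exists D'; split=> //.
    case: cases => [[eqD' v11 stb]|h]; [left | by right]; split=> // x.
    rewrite ltnS leq_eqVlt => /orP[/eqP xk|]; last exact: stb.
    have -> : x = c by apply: val_inj.
    (* A skipped vertex has an empty list, hence no neighbour. *)
    case=> u ecu; move: deg; rewrite -[k]/(val c) adj_offsetS -{2}[adj_offset L _]addn0.
    rewrite leq_add2l leqn0 size_eq0 => /eqP Lc.
    by have := (adjL c).2 u; rewrite Lc in_nil unfold_in ecu.
- rewrite big_split /= big_split /= /T big_split /= -big_distrr /=.
  by rewrite !sum_nat_const_nat /pass_cost -/A -/nb_active; lia.
- move=> s' [rs' _ [D' [fl' mD' cases]]]; split=> //; exists D'; split=> //.
  case: cases => [[eqD' v11 stb]|h]; [left | by right]; split=> // c.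
  exact: stb.
Qed.

(** Every pass but the last lowers the cardinality, which is at most [n], so there are at most
    [n.+1] passes. *)
Lemma runs_improve s D : ready s -> flags s 2 D -> maximal_independent D ->
  runs w improve s (n.+1 * (pass_cost + 4) + 4) (fun s' => ready s' /\
    exists D', [/\ flags s' 2 D', maximal_independent D' & stable D']).
Proof.
move=> rs fl mD.
have loop d s1 (D1 : {set 'I_n}) : #|D1| <= d -> ready s1 -> flags s1 2 D1 ->
    maximal_independent D1 -> var s1 1 = 1 ->
    runs w (While (Var 1) (Seq (Assign 1 (Const 0)) pass)) s1
      (d.+1 * (pass_cost + 4) + 2) (fun s' => ready s' /\
    exists D', [/\ flags s' 2 D', maximal_independent D' & stable D']).
  elim: d.+1 {-2}d (leqnn d.+1) s1 D1 => // b IH {}d db s1 D1 le rs1 fl1 mD1 v1.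
  have [s2 [t2 [ex2 le2 [rs2 [D2 [fl2 mD2 cases]]]]]] :
    runs w (Seq (Assign 1 (Const 0)) pass) s1 (2 + pass_cost) (fun s' => ready s' /\
    exists D', [/\ flags s' 2 D', maximal_independent D'
      & [/\ D' = D1, var s' 1 = 0 & stable D1] \/ #|D'| < #|D1| /\ var s' 1 = 1]).
    apply: (runs_seq (Q1 := fun s' => [/\ ready s', flags s' 2 D1 & var s' 1 = 0])).
      by apply: runs_reset.
    by move=> s2 [rs2 fl2 v2]; apply: runs_pass.
  case: cases => [[eqD v12 stb]|[lt v12]].
    exists s2, (1 + t2 + 2).+1; split.
    - by apply: exec_while_step ex2 _; [rewrite /= v1 | constructor].
    - by rewrite /=; lia.
    - by split=> //; exists D2; split=> //; rewrite eqD.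
  case: d db le => [|d] db le; first by lia.
  have [||s3 [t3 [ex3 le3 q3]]] := IH d _ s2 D2 _ rs2 fl2 mD2 v12; try lia.
  exists s3, (1 + t2 + t3).+1; split=> //.
    by apply: exec_while_step ex2 ex3; rewrite /= v1.
  by rewrite /=; lia.
apply: runs_weaken; last by move=> s' h; exact: h.
- apply: (runs_seq (Q1 := fun s' => [/\ ready s', flags s' 2 D & var s' 1 = 1])).
    by apply: runs_assign; split=> //; rewrite /= /upd /= mod_word //; lia.
  move=> s1 [rs1 fl1 v1]; apply: (loop n _ D) => //.
  by rewrite -[X in _ <= X](card_ord n) max_card.
- by rewrite /=; lia.
Qed.

Lemma runs_output s D : ready s -> flags s 2 D ->
  runs w output s (30 * n + 30) (fun s' => outputs s' D).
Proof.
move=> [v0 _ _] fl.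
pose Inv k s' := [/\ var s' 0 = n, arr s' 2 = arr s 2, var s' 3 = k, var s' 8 <= k
  & [seq arr s' 0 i | i <- iota 0 (var s' 8)] = [seq x <- iota 0 k | arr s 2 x != 0]].
apply: runs_weaken; last by move=> s' h; exact: h.
- apply: runs_seq.
    by apply: runs_reset; exact: (erefl (set_var s 8 0)).
  move=> s1 <-; apply: (runs_seq (Q1 := Inv 0)).
    by apply: runs_reset; split.
  move=> s2 i2; apply: (runs_seq (Q1 := Inv n)).
    apply: (runs_for_const (Inv := Inv) (T := 10) (lo := 0) (hi := n)) i2 => //.
    + by lia.
    + by move=> k s' _ [v0' _ v3 _ _].
    + move=> k s' /andP[_ kn] [v0' a2 v3 v8 eqs].
      apply: (runs_weaken (T := (2 + 7).+1));
        [apply: runs_if | by [] | by move=> ? h; exact: h].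
      rewrite /= v3 a2; case: ifP => ak.
        apply: (runs_weaken (T := 3 + 4));
          [apply: runs_seq | by [] | by move=> ? h; exact: h].
          apply: runs_put.
          exact: (erefl (set_arr s' 0 (var s' 8) (var s' 3))).
        move=> s3 <-; apply: runs_assign.
        have -> : eval w (set_arr s' 0 (var s' 8) (var s' 3)) (succ (Var 8)) =
            (var s' 8).+1.
          by rewrite eval_succ //=; lia.
        split=> //; split=> //.
        set s4 := set_var _ 3 _.
        have -> : var s4 8 = var s' 8 + 1 by rewrite addn1.
        rewrite -[k.+1]addn1 !iotaD !add0n filter_cat map_cat -eqs [filter _ _]/= ak.
        have -> : [seq arr s4 0 i | i <- iota (var s' 8) 1] = [:: k].
          by rewrite /s4 /= /upd /= eqxx v3.
        congr (_ ++ _); apply/eq_in_map => i; rewrite mem_iota add0n => /andP[_ lt].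
        by rewrite /s4 /= /upd /= ltn_eqF.
      apply: (runs_weaken (T := 1));
        [apply: runs_skip | by [] | by move=> ? h; exact: h].
      split=> //; split=> //; first exact: leqW.
      by rewrite -[k.+1]addn1 iotaD filter_cat add0n [filter _ (iota k 1)]/= ak cats0.
  move=> s3 [v0' a2 v3 v8 eqs]; apply: runs_assign; rewrite /outputs /=.
  rewrite /upd /= eqs; apply: uniq_perm.
  + by rewrite filter_uniq ?iota_uniq.
  + by rewrite map_inj_uniq ?enum_uniq //; apply: val_inj.
  + move=> x; rewrite mem_filter mem_iota /= add0n.
    apply/andP/mapP => [[ax xn]|[v vD ->]].
      exists (Ordinal xn); rewrite ?mem_enum //.
      by move: ax; rewrite (fl (Ordinal xn)) eqb0 negbK.
    by rewrite ltn_ord fl; rewrite mem_enum in vD; rewrite vD.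
- by rewrite /=; lia.
Qed.

Lemma runs_local_search :
  runs w local_search (input_state L)
    (60 * n + 20 * M + 60 + (n.+1 * (pass_cost + 4) + 4 + (30 * n + 30)))
    (fun s' => exists D, [/\ outputs s' D, maximal_independent D & stable D]).
Proof.
have rs : ready (input_state L) by [].
have fl : flags (input_state L) 2 set0 by move=> v; rewrite inE.
apply: runs_seq; first by apply: (runs_complete _ rs fl) => // x y; rewrite inE.
move=> s1 [k1 [D1 [f1 _ i1 d1]]]; have rs1 := @keeps_ready 2 _ _ isT k1 rs.
apply: runs_seq; first exact: (runs_improve rs1 f1).
move=> s2 [rs2 [D2 [f2 m2 st2]]].
apply: runs_weaken (runs_output rs2 f2) _ _ => // s3 out.
by exists D2.
Qed.

(** The lists enumerate the ordered pairs of adjacent vertices, and each edge arises from at most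
    two of them. *)
Lemma arcs_le_edges : M <= 2 * #|edges e|.
Proof.
pose A := [set p : 'I_n * 'I_n | e p.1 p.2].
pose f (p : 'I_n * 'I_n) := [set p.1; p.2].
have -> : M = #|A|.
  rewrite -sum1_card /nb_arcs /adj_offset.
  transitivity (\sum_(u < n) \sum_(v < n | e u v) 1).
    apply: eq_big => [u|u _]; rewrite ?ltn_ord //.
    have [uL mL] := adjL u; rewrite -(card_uniqP uL) -sum1_card.
    by apply: eq_bigl => v; rewrite mL.
  by rewrite pair_big_dep /=; apply: eq_bigl => p; rewrite inE.
have edgesE : edges e = f @: A.
  by apply/setP => E; apply/imsetP/imsetP => -[p hp ->]; exists p; rewrite ?inE in hp *.
rewrite edgesE -sum1_card (partition_big f (mem (f @: A))) /=; last first.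
  by move=> p pA; apply: imset_f.
rewrite mulnC -sum_nat_const; apply: leq_sum => E /imsetP[q qA ->].
rewrite sum1_card; apply: (@leq_trans #|[set q; (q.2, q.1)]|);
  last by rewrite cards2; case: (_ == _).
apply: subset_leq_card; apply/subsetP => -[x y]; rewrite unfold_in /= !inE /=.
case: q qA => a b; rewrite inE /f /= => eab /andP[exy /eqP eqE].
have xE : x \in [set a; b] by rewrite -eqE !inE eqxx.
have yE : y \in [set a; b] by rewrite -eqE !inE eqxx orbT.
have nxy : x != y by apply: contraTneq exy => ->; rewrite eI.
move: xE yE nxy; rewrite !inE !xpair_eqE.
by do 2!case/orP=> /eqP->; rewrite ?eqxx ?orbT.
Qed.

End Program.

(** * The overall time bound and approximation ratio *)

(** In [(n + M + 1) * W], bound [n * W] through [W <= M] and [M * W] through [W <= n]; both become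
    multiples of [n * m]. The passes contribute the other factor [n], and [0 < m] absorbs the terms
    free of [m]. *)
Lemma search_time_bound n m M W :
  0 < n -> 0 < m -> M <= 2 * m -> W <= n -> W <= M ->
  60 * n + 20 * M + 60 +
    (n.+1 * (30 * n + 200 * (n + M + 1) * W + 30 + 4) + 4 + (30 * n + 30))
  <= 5000 * (n ^ 2 * m).
Proof.
move=> n0 m0 Mm Wn WM.
have nm : n <= n * m by rewrite leq_pmulr.
have nnm : n * m <= n * (n * m) by rewrite leq_pmull.
have mnm : m <= n * m by rewrite leq_pmull.
have Wb : (n + M + 1) * W <= 6 * (n * m).
  have h1 : n * W <= n * (2 * m) by rewrite leq_mul // (leq_trans WM).
  have h2 : M * W <= (2 * m) * n by apply: leq_mul.
  have h3 : W <= 2 * m by apply: leq_trans WM _.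
  by lia.
have pb : 30 * n + 200 * (n + M + 1) * W + 30 + 4 <= 1300 * (n * m) by lia.
have : n.+1 * (30 * n + 200 * (n + M + 1) * W + 30 + 4) <= (2 * n) * (1300 * (n * m)).
  by apply: leq_mul => //; lia.
by rewrite -mulnn; lia.
Qed.

Theorem theorem3 (R : realType) :
  exists (prog : cmd) (C k : nat),
    forall (n : nat) (e : rel 'I_n) (L : 'I_n -> seq 'I_n) (w : nat),
      let m := #|edges e| in
      unit_disk_graph R e ->
      adjacency_lists e L ->
      (n + m + 2) ^ k <= 2 ^ w ->
      exists (s : state) (t : nat) (D : {set 'I_n}),
        [/\ exec w prog (input_state L) s t,
            (0 < m -> t <= C * (n ^ 2 * m)),
            outputs s D,
            dominating e D
          & forall Dmin : {set 'I_n}, minimum_dominating e Dmin ->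
              (#|D|%:R <= 43%:R / 9%:R * #|Dmin|%:R :> rat)%R].
Proof.
exists local_search, 5000, 3 => n e L w m udg adjL fitk.
have [[eC eI] _] := udg.
have Mm : nb_arcs L <= 2 * m by apply: arcs_le_edges.
have fit : n + nb_arcs L + 4 < 2 ^ w.
  (* The cube of [n + m + 2] is at least [4 * (n + m + 2)], which exceeds [n + 2 * m + 4]. *)
  apply: leq_trans fitk; rewrite !expnS expn0 muln1.
  have : 2 * 2 <= (n + m + 2) * (n + m + 2) by apply: leq_mul; lia.
  move=> h; have : (n + m + 2) * (2 * 2) <= (n + m + 2) * ((n + m + 2) * (n + m + 2)).
    by apply: leq_mul.
  by lia.
have [s [t [ex le [D [out [iD dD] stb]]]]] := runs_local_search eC eI adjL fit.
exists s, t, D; split;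
  [exact: ex | move=> m0 | exact: out | exact: dD | move=> Dmin [domB _]].
  apply: leq_trans le _; apply: search_time_bound => //.
  - by have /card_gt0P[E /imsetP[[[x xn] _] _ _]] := m0; apply: leq_ltn_trans xn.
  - exact: active_le_n.
  - exact: active_le_arcs.
have := unit_disk_local_optimum udg iD dD domB stb.
rewrite -(ler_nat rat) !natrM => h.
by lra.
Qed.
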